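(* Let $A$ be a uT-algebra which is weakly regular and functionally continuous. Let $B$ be an lmc algebra and let $\Phi: A \to B$ be an injective algebra homomorphism such that $C := \overline{\operatorname{Im}\Phi}$ (closure in $B$, with the topology induced by $B$) is a Q-algebra. Then the following are equivalent: (1) the map $\Phi^{-1}|_{\operatorname{Im}\Phi} : \operatorname{Im}\Phi \to A$ is continuous, where $\operatorname{Im}\Phi$ carries the topology induced by $B$; (2) $\operatorname{Im}\Phi$ (with the topology induced by $B$) is functionally continuous; (3) the map $\Phi^*: M(C) \to M(A)$, $\Phi^*(f) = f\circ\Phi$, is surjective; (4) $\operatorname{Im}\Phi \cap R(C) = \{0\}$.
   Context: All algebras are complex, commutative and have a unit. A topological algebra is an algebra that is also a Hausdorff topological vector space in which multiplication is separately continuous. An lmc algebra is a topological algebra whose topology is determined by a family of submultiplicative seminorms. A uniform seminorm on an algebra is a seminorm $p$ with $p(x^2)=p(x)^2$ for all $x$; a uT-algebra is a topological algebra whose topology is determined by a family of uniform seminorms. For an algebra $A$, $M^*(A)$ is the set of all nonzero multiplicative linear functionals on $A$; for a topological algebra $A$, $M(A)$ is the set of nonzero continuous multiplicative linear functionals. A topological algebra $A$ is functionally continuous if $M^*(A)=M(A)$. A topological algebra is a Q-algebra if its set of invertible elements is open. A topological algebra $A$ is weakly regular if for every closed subset $F \subsetneq M(A)$ (with the weak* topology) there is a nonzero $x\in A$ with $f(x)=0$ for all $f\in F$. $R(C)$ denotes the (Jacobson) radical of the algebra $C$. *)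

(* Defs.v *)
From Stdlib Require Import Reals List.
Open Scope R_scope.

Definition Cx : Type := (R * R)%type.
Definition C0 : Cx := (0, 0).
Definition C1 : Cx := (1, 0).
Definition Cadd (z w : Cx) : Cx := (fst z + fst w, snd z + snd w).
Definition Copp (z : Cx) : Cx := (- fst z, - snd z).
Definition Csub (z w : Cx) : Cx := Cadd z (Copp w).
Definition Cmul (z w : Cx) : Cx :=
  (fst z * fst w - snd z * snd w, fst z * snd w + snd z * fst w).
Definition Cmod (z : Cx) : R := sqrt (fst z * fst z + snd z * snd z).

Record CAlg := {
  car :> Type;
  zero : car;
  one : car;
  add : car -> car -> car;
  opp : car -> car;
  mul : car -> car -> car;
  scal : Cx -> car -> car;
  addA : forall x y z, add x (add y z) = add (add x y) z;
  addC : forall x y, add x y = add y x;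
  add0 : forall x, add zero x = x;
  addN : forall x, add x (opp x) = zero;
  mulA : forall x y z, mul x (mul y z) = mul (mul x y) z;
  mulC : forall x y, mul x y = mul y x;
  mul1 : forall x, mul one x = x;
  mulDl : forall x y z, mul (add x y) z = add (mul x z) (mul y z);
  scalA : forall a b x, scal a (scal b x) = scal (Cmul a b) x;
  scal1 : forall x, scal C1 x = x;
  scalDl : forall a b x, scal (Cadd a b) x = add (scal a x) (scal b x);
  scalDr : forall a x y, scal a (add x y) = add (scal a x) (scal a y);
  scalMl : forall a x y, scal a (mul x y) = mul (scal a x) y
}.

Definition asub (A : CAlg) (x y : A) : A := add A x (opp A y).

Record SNAlg := {
  alg :> CAlg;
  idx : Type;
  sn : idx -> alg -> R;
  sn_triangle : forall i x y, sn i (add alg x y) <= sn i x + sn i y;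
  sn_scal : forall i a x, sn i (scal alg a x) = Cmod a * sn i x
}.

(* ---------- Topology generated by a family of seminorms, relative to a
   subset S (the subspace topology).  [sopen p sub S U] means that the
   trace U ∩ S is open in S. ---------- *)
Definition sopen {T I : Type} (p : I -> T -> R) (sub : T -> T -> T)
  (S U : T -> Prop) : Prop :=
  forall x, S x -> U x ->
    exists (l : list I) (e : R), 0 < e /\
      forall y, S y -> (forall i, In i l -> p i (sub y x) < e) -> U y.

Definition scont {T1 I1 T2 I2 : Type}
  (p1 : I1 -> T1 -> R) (sub1 : T1 -> T1 -> T1) (S1 : T1 -> Prop)
  (p2 : I2 -> T2 -> R) (sub2 : T2 -> T2 -> T2) (S2 : T2 -> Prop)
  (f : T1 -> T2) : Prop :=
  forall U, sopen p2 sub2 S2 U -> sopen p1 sub1 S1 (fun x => U (f x)).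

Definition whole {T : Type} : T -> Prop := fun _ => True.

Definition Aopen (A : SNAlg) (S U : A -> Prop) : Prop :=
  sopen (sn A) (asub A) S U.

Definition Cseminorm : unit -> Cx -> R := fun _ z => Cmod z.

Definition Acont (A : SNAlg) (S : A -> Prop) (B : SNAlg) (S' : B -> Prop)
  (f : A -> B) : Prop :=
  scont (sn A) (asub A) S (sn B) (asub B) S' f.

Definition Ccont (A : SNAlg) (S : A -> Prop) (f : A -> Cx) : Prop :=
  scont (sn A) (asub A) S Cseminorm Csub whole f.

Definition hausdorff (A : SNAlg) : Prop :=
  forall x : A, x <> zero A -> exists i, sn A i x <> 0.

Definition topological_algebra (A : SNAlg) : Prop :=
  hausdorff A /\
  forall a : A, Acont A whole A whole (fun x => mul A a x).

Definition is_lmc (A : SNAlg) : Prop :=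
  topological_algebra A /\
  forall i (x y : A), sn A i (mul A x y) <= sn A i x * sn A i y.

Definition is_uT (A : SNAlg) : Prop :=
  topological_algebra A /\
  forall i (x : A), sn A i (mul A x x) = (sn A i x) ^ 2.

Definition mlf (A : CAlg) (S : A -> Prop) (f : A -> Cx) : Prop :=
  (forall x y, S x -> S y -> f (add A x y) = Cadd (f x) (f y)) /\
  (forall a x, S x -> f (scal A a x) = Cmul a (f x)) /\
  (forall x y, S x -> S y -> f (mul A x y) = Cmul (f x) (f y)) /\
  (exists x, S x /\ f x <> C0).

Definition Mstar (A : SNAlg) (S : A -> Prop) (f : A -> Cx) : Prop := mlf A S f.
Definition Mcont (A : SNAlg) (S : A -> Prop) (f : A -> Cx) : Prop :=
  mlf A S f /\ Ccont A S f.

Definition functionally_continuous (A : SNAlg) (S : A -> Prop) : Prop :=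
  forall f, Mstar A S f -> Mcont A S f.

Definition wstar_seminorm (A : CAlg) : A -> (A -> Cx) -> R :=
  fun x f => Cmod (f x).
Definition fsub (A : CAlg) (f g : A -> Cx) : A -> Cx :=
  fun x => Csub (f x) (g x).

Definition weakly_regular (A : SNAlg) : Prop :=
  forall F : (A -> Cx) -> Prop,
    (forall f, F f -> Mcont A whole f) ->
    (exists g, Mcont A whole g /\ ~ F g) ->
    sopen (wstar_seminorm A) (fsub A) (Mcont A whole) (fun f => ~ F f) ->
    exists x : A, x <> zero A /\ forall f, F f -> f x = C0.

Definition closure (B : SNAlg) (S : B -> Prop) (x : B) : Prop :=
  forall U, Aopen B whole U -> U x -> exists y, S y /\ U y.

Definition invertible_in (B : CAlg) (S : B -> Prop) (x : B) : Prop :=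
  S x /\ exists y, S y /\ mul B x y = one B.

Definition Q_algebra (B : SNAlg) (S : B -> Prop) : Prop :=
  Aopen B S (invertible_in B S).

Definition ideal_of (B : CAlg) (S I : B -> Prop) : Prop :=
  (forall x, I x -> S x) /\ I (zero B) /\
  (forall x y, I x -> I y -> I (add B x y)) /\
  (forall x, I x -> I (opp B x)) /\
  (forall c x, S c -> I x -> I (mul B c x)).

Definition maximal_ideal_of (B : CAlg) (S I : B -> Prop) : Prop :=
  ideal_of B S I /\ ~ I (one B) /\
  forall J, ideal_of B S J -> ~ J (one B) -> (forall x, I x -> J x) ->
    forall x, J x -> I x.

Definition radical (B : CAlg) (S : B -> Prop) (x : B) : Prop :=
  S x /\ forall I, maximal_ideal_of B S I -> I x.

Definition alg_hom (A B : CAlg) (phi : A -> B) : Prop :=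
  (forall x y, phi (add A x y) = add B (phi x) (phi y)) /\
  (forall a x, phi (scal A a x) = scal B a (phi x)) /\
  (forall x y, phi (mul A x y) = mul B (phi x) (phi y)) /\
  phi (one A) = one B.

Definition image {A B : Type} (phi : A -> B) (b : B) : Prop :=
  exists a, phi a = b.

(* Main.v *)
(* We go round (1) => (2) => (3) => (4) => (3) => (1).  Under (1) a character of
   Im Phi is a character of A, continuous by hypothesis, composed with Phi^-1.
   A continuous character of Im Phi extends to C by completeness of the complex
   numbers, whence (3).  Since C is a Q-algebra, one continuous seminorm P on C
   dominates all its characters.  Hence the restrictions f o Phi form a closed
   subset of M(A): a limit g satisfies |g| <= P o Phi and so extends to C.  If
   (3) fails, weak regularity gives x <> 0 with Phi x killed by all characters
   of C, that is, Phi x in R(C), against (4).  Under (3) each uniform seminorm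
   p of A satisfies p x = |g x| <= P (Phi x) for a character g depending on x,
   which gives (1), and, A being Hausdorff, (4).

   Two facts about characters are needed, and no completion or holomorphic
   calculus is used for them.
   - If p is a uniform seminorm and p x > 0, some character g satisfies
     |g| <= p and |g x| = p x.  Take q minimal, by Zorn, among the uniform
     seminorms below p that agree with p at x.  For q a > 0 the seminorm
     inf_n q (y a^n) / (q a)^n is again in the family, so q is multiplicative.
     A Gelfand-Mazur argument that only needs square roots of complex numbers
     shows that every y is a scalar modulo the kernel of q.
   - A proper ideal I of C is killed by a character: the spectral radius modulo
     I is a uniform seminorm, is at least 1 at the unit, and vanishes on I. *)

From Stdlib Require Import Reals List Lra Lia IndefiniteDescription Classical.
From Stdlib Require Import ClassicalEpsilon ProofIrrelevance.
From mathcomp Require boolp classical_sets.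
Require Import Defs.

(** * Complex numbers *)

Lemma Cx_ring : ring_theory C0 C1 Cadd Cmul Csub Copp eq.
Proof.
  constructor; intros; repeat match goal with z : Cx |- _ => destruct z end;
    unfold C0, C1, Csub, Cadd, Cmul, Copp; cbn; f_equal; ring.
Qed.
Add Ring Cx_ring : Cx_ring.

Lemma Cmod_sqr z : Cmod z * Cmod z = fst z * fst z + snd z * snd z.
Proof. apply sqrt_sqrt; nra. Qed.

Lemma Cmod_nonneg z : 0 <= Cmod z.
Proof. apply sqrt_pos. Qed.

Lemma Cmod_C0 : Cmod C0 = 0.
Proof.
  unfold Cmod, C0; cbn; replace (0 * 0 + 0 * 0) with 0 by ring; apply sqrt_0.
Qed.

Lemma Cmod_C1 : Cmod C1 = 1.
Proof.
  unfold Cmod, C1; cbn; replace (1 * 1 + 0 * 0) with 1 by ring; apply sqrt_1.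
Qed.

Lemma Cmod_eq0 z : Cmod z = 0 -> z = C0.
Proof.
  intros h; pose proof (Cmod_sqr z) as e; rewrite h in e.
  destruct z as [a b]; cbn in e; unfold C0; f_equal; nra.
Qed.

Lemma Cmod_mul z w : Cmod (Cmul z w) = Cmod z * Cmod w.
Proof.
  unfold Cmod; rewrite <- sqrt_mult by nra; f_equal; cbn; ring.
Qed.

Lemma Cmod_opp z : Cmod (Copp z) = Cmod z.
Proof. unfold Cmod; f_equal; cbn; ring. Qed.

Lemma Cmod_real a : Cmod (a, 0) = Rabs a.
Proof.
  unfold Cmod; cbn; rewrite <- sqrt_Rsqr_abs; f_equal; unfold Rsqr; ring.
Qed.

Lemma fst_le_Cmod z : Rabs (fst z) <= Cmod z.
Proof.
  rewrite <- sqrt_Rsqr_abs; apply sqrt_le_1_alt; unfold Rsqr; nra.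
Qed.

Lemma snd_le_Cmod z : Rabs (snd z) <= Cmod z.
Proof.
  rewrite <- sqrt_Rsqr_abs; apply sqrt_le_1_alt; unfold Rsqr; nra.
Qed.

Lemma Cmod_triangle z w : Cmod (Cadd z w) <= Cmod z + Cmod w.
Proof.
  pose proof (Cmod_nonneg z) as hz; pose proof (Cmod_nonneg w) as hw.
  apply Rsqr_incr_0_var; [|lra]; unfold Rsqr.
  pose proof (Cmod_sqr z) as ez; pose proof (Cmod_sqr w) as ew.
  rewrite Cmod_sqr.
  assert (h : fst z * fst w + snd z * snd w <= Cmod z * Cmod w).
  { apply Rle_trans with (1 := Rle_abs _); rewrite <- sqrt_Rsqr_abs.
    rewrite <- (sqrt_Rsqr (Cmod z * Cmod w)) by nra.
    apply sqrt_le_1_alt; unfold Rsqr.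
    replace (Cmod z * Cmod w * (Cmod z * Cmod w))
      with ((Cmod z * Cmod z) * (Cmod w * Cmod w)) by ring.
    rewrite ez, ew.
    pose proof (Rle_0_sqr (fst z * snd w - snd z * fst w)) as h; unfold Rsqr in h.
    lra. }
  cbn; nra.
Qed.

Lemma Cmod_le_parts z : Cmod z <= Rabs (fst z) + Rabs (snd z).
Proof.
  replace z with (Cadd (fst z, 0) (Cmul (0, 1) (snd z, 0))) at 1.
  2: destruct z; unfold Cadd, Cmul; cbn; f_equal; ring.
  apply Rle_trans with (1 := Cmod_triangle _ _); rewrite Cmod_mul, !Cmod_real.
  replace (Cmod (0, 1)) with 1; [lra|].
  unfold Cmod; cbn; replace (0 * 0 + 1 * 1) with 1 by ring; symmetry; apply sqrt_1.
Qed.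

Definition Cinv (z : Cx) : Cx :=
  (fst z / (Cmod z * Cmod z), - snd z / (Cmod z * Cmod z)).

Lemma Cinv_r z : z <> C0 -> Cmul z (Cinv z) = C1.
Proof.
  intros h; assert (h' : Cmod z * Cmod z <> 0).
  { intros e; apply h, Cmod_eq0; nra. }
  unfold Cinv; rewrite Cmod_sqr in *; destruct z as [a b]; cbn in *.
  unfold Cmul, C1; cbn; f_equal; field; exact h'.
Qed.

Lemma Cmod_inv z : z <> C0 -> Cmod (Cinv z) = / Cmod z.
Proof.
  intros h; pose proof (Cinv_r z h) as e; apply (f_equal Cmod) in e.
  rewrite Cmod_mul, Cmod_C1 in e.
  assert (Cmod z <> 0) by (intros e0; rewrite e0 in e; lra).
  apply Rmult_eq_reg_l with (Cmod z); [rewrite e; field|]; assumption.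
Qed.

Lemma C1_neq_C0 : C1 <> C0.
Proof. unfold C1, C0; injection 1; lra. Qed.

Lemma Cmul_integral z w : Cmul z w = C0 -> z = C0 \/ w = C0.
Proof.
  intros h; apply (f_equal Cmod) in h; rewrite Cmod_mul, Cmod_C0 in h.
  apply Rmult_integral in h; destruct h; [left|right]; apply Cmod_eq0; assumption.
Qed.

Lemma Csqrt_exists w : exists v, Cmul v v = w.
Proof.
  pose proof (Rle_abs (fst w)) as h1; pose proof (Rle_abs (- fst w)) as h2.
  rewrite Rabs_Ropp in h2; pose proof (fst_le_Cmod w) as h3.
  pose proof (Cmod_sqr w) as e; destruct w as [a b]; cbn in *.
  set (m := Cmod (a, b)) in *.
  (* The parts of a root, up to sign, solve u^2 + v^2 = m and u^2 - v^2 = a; the sign of [b] then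
     decides the sign of the imaginary part. *)
  pose (u := sqrt ((m + a) / 2)); pose (v := sqrt ((m - a) / 2)).
  assert (hu : u * u = (m + a) / 2) by (apply sqrt_sqrt; lra).
  assert (hv : v * v = (m - a) / 2) by (apply sqrt_sqrt; lra).
  assert (huv : 2 * (u * v) = Rabs b).
  { apply Rsqr_inj.
    - assert (0 <= u /\ 0 <= v) by (split; apply sqrt_pos); nra.
    - apply Rabs_pos.
    - rewrite <- Rsqr_abs; unfold Rsqr.
      replace (2 * (u * v) * (2 * (u * v))) with (4 * ((u * u) * (v * v))) by ring.
      rewrite hu, hv; lra. }
  destruct (Rle_or_lt 0 b) as [hb|hb].
  - exists (u, v); rewrite Rabs_pos_eq in huv by lra.
    unfold Cmul; cbn; f_equal; lra.
  - exists (u, - v); rewrite Rabs_left in huv by lra.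
    unfold Cmul; cbn; f_equal; lra.
Qed.

(** * Real inequalities, infima and limits *)

Lemma le_of_forall_eps x y : (forall e, 0 < e -> x <= y + e) -> x <= y.
Proof.
  intros h; destruct (Rle_or_lt x y) as [|hlt]; [assumption|].
  specialize (h ((x - y) / 2)); lra.
Qed.

Lemma le_mul_of_lt a b c : 0 <= a -> 0 <= b ->
  (forall s t, a < s -> b < t -> c <= s * t) -> c <= a * b.
Proof.
  intros ha hb h; apply le_of_forall_eps; intros e he.
  assert (hd : 0 < e / (a + b + 1)) by (apply Rdiv_lt_0_compat; lra).
  (* With this [d], (a + d)(b + d) <= ab + d(a + b + 1) <= ab + e. *)
  pose (d := Rmin 1 (e / (a + b + 1))).
  assert (hd1 : 0 < d) by (apply Rmin_glb_lt; lra).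
  assert (hd2 : d <= 1) by apply Rmin_l.
  assert (hd3 : d * (a + b + 1) <= e).
  { apply Rle_trans with (e / (a + b + 1) * (a + b + 1)).
    - apply Rmult_le_compat_r; [lra|apply Rmin_r].
    - right; field; lra. }
  specialize (h (a + d) (b + d)); nra.
Qed.

(** If a > b, Bernoulli's inequality makes (a/b)^N grow at least linearly, past [K]. Asking only for
    arbitrarily large exponents allows the use of powers of two. *)
Lemma le_of_pow_le K a b : 0 <= a -> 0 < b ->
  (forall n, exists N, (n <= N)%nat /\ a ^ N <= K * b ^ N) -> a <= b.
Proof.
  intros ha hb h; destruct (Rle_or_lt a b) as [|hlt]; [assumption|exfalso].
  assert (hd : 0 < a / b - 1).
  { enough (1 < a / b) by lra; apply Rmult_lt_reg_r with b; [lra|].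
    replace (a / b * b) with a by (field; lra); lra. }
  destruct (INR_unbounded (K / (a / b - 1))) as [n hn].
  destruct (h n) as [N [hN hle]].
  pose proof (poly N _ hd) as hp.
  replace (1 + (a / b - 1)) with (a / b) in hp by ring.
  pose proof (pow_lt b N hb) as hbN.
  assert (hK : (a / b) ^ N <= K).
  { apply Rmult_le_reg_r with (1 := hbN); rewrite <- Rpow_mult_distr.
    replace (a / b * b) with a by (field; lra); exact hle. }
  apply le_INR in hN.
  assert (hK' : K < INR n * (a / b - 1)).
  { apply Rmult_lt_reg_r with (/ (a / b - 1)); [apply Rinv_0_lt_compat, hd|].
    rewrite Rmult_assoc, Rinv_r, Rmult_1_r by lra; exact hn. }
  nra.
Qed.

Lemma pow_near_one N : forall d, 0 < d -> exists e, 0 < e /\ (1 + e) ^ N <= 1 + d.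
Proof.
  induction N as [|N IH]; intros d hd.
  - exists 1; cbn; lra.
  - pose (c := Rmin 1 d); assert (hc : 0 < c) by (apply Rmin_glb_lt; lra).
    assert (c <= 1) by apply Rmin_l; assert (c <= d) by apply Rmin_r.
    destruct (IH (c / 3)) as [e [he h]]; [lra|].
    pose (e' := Rmin e (c / 3)); assert (he' : 0 < e') by (apply Rmin_glb_lt; lra).
    assert (e' <= e) by apply Rmin_l; assert (e' <= c / 3) by apply Rmin_r.
    exists e'; split; [exact he'|cbn].
    assert ((1 + e') ^ N <= (1 + e) ^ N) by (apply pow_incr; lra).
    assert (0 < (1 + e') ^ N) by (apply pow_lt; lra).
    apply Rle_trans with ((1 + c / 3) * (1 + c / 3)); [apply Rmult_le_compat|]; nra.
Qed.

Lemma eq_of_Cmod_small z w : (forall e, 0 < e -> Cmod (Csub z w) <= e) -> z = w.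
Proof.
  intros h; assert (e : Cmod (Csub z w) = 0).
  { apply Rle_antisym; [|apply Cmod_nonneg].
    apply le_of_forall_eps; intros e he; rewrite Rplus_0_l; apply h; exact he. }
  apply Cmod_eq0 in e; replace z with (Cadd (Csub z w) w) by ring; rewrite e; ring.
Qed.

Definition is_inf (E : R -> Prop) (m : R) : Prop :=
  0 <= m /\ (forall x, E x -> m <= x) /\
  forall e, 0 < e -> exists x, E x /\ x < m + e.

Lemma inf_exists (E : R -> Prop) :
  (exists x, E x) -> (forall x, E x -> 0 <= x) -> exists m, is_inf E m.
Proof.
  intros [x0 hx0] hE.
  destruct (completeness (fun t => E (- t))) as [m [h1 h2]].
  - exists 0; intros t ht; apply hE in ht; lra.
  - exists (- x0); rewrite Ropp_involutive; exact hx0.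
  - exists (- m); split; [|split].
    + enough (m <= 0) by lra; apply h2; intros t ht; apply hE in ht; lra.
    + intros x hx; enough (- x <= m) by lra.
      apply h1; rewrite Ropp_involutive; exact hx.
    + intros e he; apply NNPP; intros hn.
      enough (m <= m - e) by lra; apply h2; intros t ht.
      destruct (Rle_or_lt t (m - e)) as [|hlt]; [assumption|].
      exfalso; apply hn; exists (- t); split; [exact ht|lra].
Qed.

(** A pair in [Q] stands for the interval [x - t, x + t]. These intervals meet pairwise, so the
    supremum of their left ends lies in all of them. *)
Lemma R_complete (Q : R -> R -> Prop) :
  (exists t x, Q t x) ->
  (forall t t' x x', Q t x -> Q t' x' -> Rabs (x - x') <= t + t') ->
  exists s, forall t x, Q t x -> Rabs (s - x) <= t.
Proof.
  intros [t0 [x0 h0]] hQ.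
  destruct (completeness (fun y => exists t x, Q t x /\ y = x - t)) as [s [h1 h2]].
  - exists (x0 + t0); intros y [t [x [h ->]]].
    pose proof (Rle_trans _ _ _ (Rle_abs _) (hQ _ _ _ _ h h0)); lra.
  - exists (x0 - t0), t0, x0; auto.
  - exists s; intros t x h; apply Rabs_le; split.
    + enough (x - t <= s) by lra; apply h1; exists t, x; auto.
    + enough (s <= x + t) by lra; apply h2; intros y [t' [x' [h' ->]]].
      pose proof (Rle_trans _ _ _ (Rle_abs _) (hQ _ _ _ _ h' h)); lra.
Qed.

(* Completeness of the complex numbers, with [Q t z] read as "z approximates
   the limit up to t". *)
Lemma C_complete (Q : R -> Cx -> Prop) :
  (exists t z, Q t z) ->
  (forall t t' z z', Q t z -> Q t' z' -> Cmod (Csub z z') <= t + t') ->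
  exists w, forall t z, Q t z -> Cmod (Csub w z) <= 2 * t.
Proof.
  intros [t0 [z0 h0]] hQ.
  destruct (R_complete (fun t x => exists z, Q t z /\ fst z = x)) as [a ha].
  - exists t0, (fst z0), z0; auto.
  - intros t t' x x' [z [h <-]] [z' [h' <-]].
    apply Rle_trans with (2 := hQ _ _ _ _ h h').
    apply (fst_le_Cmod (Csub z z')).
  - destruct (R_complete (fun t x => exists z, Q t z /\ snd z = x)) as [b hb].
    + exists t0, (snd z0), z0; auto.
    + intros t t' x x' [z [h <-]] [z' [h' <-]].
      apply Rle_trans with (2 := hQ _ _ _ _ h h').
      apply (snd_le_Cmod (Csub z z')).
    (* The factor 2 arises because the two coordinates are estimated separately. *)
    + exists (a, b); intros t z h.
      apply Rle_trans with (1 := Cmod_le_parts _); cbn.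
      assert (Rabs (a - fst z) <= t) by (apply ha; eauto).
      assert (Rabs (b - snd z) <= t) by (apply hb; eauto).
      unfold Rminus in *; lra.
Qed.

(** * Uniform seminorms and characters *)

Section Algebra.
Context (A : CAlg).

Lemma CAlg_ring : ring_theory (zero A) (one A) (add A) (mul A) (asub A) (opp A) eq.
Proof.
  constructor; intros.
  - apply add0.
  - apply addC.
  - apply addA.
  - apply mul1.
  - apply mulC.
  - apply mulA.
  - apply mulDl.
  - reflexivity.
  - apply addN.
Qed.
Add Ring CAlg_ring : CAlg_ring.

(** Writing scalar multiplication as multiplication by an element brings it within reach of
    [ring]. *)
Definition cst (a : Cx) : A := scal A a (one A).

Lemma scal_cst a x : scal A a x = mul A (cst a) x.
Proof. unfold cst; rewrite <- scalMl, mul1; reflexivity. Qed.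

Lemma cst_add a b : cst (Cadd a b) = add A (cst a) (cst b).
Proof. apply scalDl. Qed.

Lemma cst_mul a b : cst (Cmul a b) = mul A (cst a) (cst b).
Proof. rewrite <- scal_cst; unfold cst; rewrite scalA; reflexivity. Qed.

Lemma cst_1 : cst C1 = one A.
Proof. apply scal1. Qed.

Lemma cst_0 : cst C0 = zero A.
Proof.
  assert (e : add A (cst C0) (cst C0) = cst C0)
    by (rewrite <- cst_add; f_equal; ring).
  replace (cst C0) with (asub A (add A (cst C0) (cst C0)) (cst C0)) by ring.
  rewrite e; ring.
Qed.

Lemma cst_opp a : cst (Copp a) = opp A (cst a).
Proof.
  assert (e : add A (cst (Copp a)) (cst a) = zero A)
    by (rewrite <- cst_add, <- cst_0; f_equal; ring).
  replace (cst (Copp a)) with (asub A (add A (cst (Copp a)) (cst a)) (cst a)) by ring.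
  rewrite e; ring.
Qed.

Lemma cst_sub a b : cst (Csub a b) = asub A (cst a) (cst b).
Proof. unfold Csub, asub; rewrite cst_add, cst_opp; reflexivity. Qed.

Fixpoint pw (x : A) (n : nat) : A :=
  match n with O => one A | S n => mul A x (pw x n) end.

Lemma pw_add x n m : pw x (n + m) = mul A (pw x n) (pw x m).
Proof. induction n as [|n IH]; cbn; [|rewrite IH]; ring. Qed.

Lemma pw_mul x y n : pw (mul A x y) n = mul A (pw x n) (pw y n).
Proof. induction n as [|n IH]; cbn; [|rewrite IH]; ring. Qed.

Lemma pw_twice x n : pw x (2 * n) = mul A (pw x n) (pw x n).
Proof. replace (2 * n)%nat with (n + n)%nat by lia; apply pw_add. Qed.

Definition seminorm (q : A -> R) : Prop :=
  (forall x y, q (add A x y) <= q x + q y) /\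
  (forall a x, q (scal A a x) = Cmod a * q x).

Definition uniform (q : A -> R) : Prop := forall x, q (mul A x x) = q x ^ 2.

Section Seminorm.
Context (q : A -> R) (sq : seminorm q).

Lemma seminorm_scal a x : q (mul A (cst a) x) = Cmod a * q x.
Proof. rewrite <- scal_cst; apply sq. Qed.

Lemma seminorm_0 : q (zero A) = 0.
Proof.
  replace (zero A) with (mul A (cst C0) (zero A)) by ring.
  rewrite seminorm_scal, Cmod_C0; ring.
Qed.

Lemma seminorm_opp x : q (opp A x) = q x.
Proof.
  replace (opp A x) with (mul A (cst (Copp C1)) x).
  - rewrite seminorm_scal, Cmod_opp, Cmod_C1; ring.
  - rewrite cst_opp, cst_1; ring.
Qed.

Lemma seminorm_nonneg x : 0 <= q x.
Proof.
  assert (h : q (add A x (opp A x)) <= q x + q (opp A x)) by apply sq.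
  replace (add A x (opp A x)) with (zero A) in h by ring.
  rewrite seminorm_0, seminorm_opp in h; lra.
Qed.

Lemma seminorm_sub x y : q (asub A x y) <= q x + q y.
Proof. rewrite <- (seminorm_opp y); apply sq. Qed.

Lemma seminorm_sub_sym x y : q (asub A x y) = q (asub A y x).
Proof. rewrite <- seminorm_opp; f_equal; ring. Qed.

Lemma seminorm_le_sub x y : q x <= q (asub A x y) + q y.
Proof.
  replace x with (add A (asub A x y) y) at 1 by ring; apply sq.
Qed.

End Seminorm.

(** For a nonzero scalar, the reverse inequality is the assumed one applied to the inverse of [a]
    and the element [a x]. *)
Lemma seminorm_of_le (q : A -> R) :
  (forall x, 0 <= q x) ->
  (forall x y, q (add A x y) <= q x + q y) ->
  (forall a x, q (scal A a x) <= Cmod a * q x) -> q (zero A) = 0 ->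
  seminorm q.
Proof.
  intros h0 ht hs hz; split; [exact ht|intros a x].
  apply Rle_antisym; [apply hs|].
  destruct (classic (a = C0)) as [->|ha].
  - rewrite scal_cst, cst_0, Cmod_C0.
    replace (mul A (zero A) x) with (zero A) by ring; rewrite hz; lra.
  - assert (e : x = scal A (Cinv a) (scal A a x)).
    { rewrite !scal_cst.
      replace (mul A (cst (Cinv a)) (mul A (cst a) x))
        with (mul A (mul A (cst a) (cst (Cinv a))) x) by ring.
      rewrite <- cst_mul, Cinv_r, cst_1 by exact ha; ring. }
    assert (ha' : 0 < Cmod a).
    { destruct (Cmod_nonneg a) as [|e']; [assumption|].
      symmetry in e'; apply Cmod_eq0 in e'; contradiction. }
    rewrite e at 1; specialize (hs (Cinv a) (scal A a x)).
    rewrite Cmod_inv in hs by exact ha.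
    apply (Rmult_le_compat_l (Cmod a)) in hs; [|lra].
    rewrite <- Rmult_assoc, Rinv_r, Rmult_1_l in hs by lra; exact hs.
Qed.

(* Directed infima; chains of seminorms and the sequences
   [q (y a^n) / q(a)^n] are both instances. *)
Lemma directed_inf_seminorm (F : (A -> R) -> Prop) :
  (exists q, F q) -> (forall q, F q -> seminorm q) ->
  (forall q1 q2, F q1 -> F q2 -> exists q3, F q3 /\
     (forall x, q3 x <= q1 x) /\ forall x, q3 x <= q2 x) ->
  exists r, seminorm r /\
    forall x, is_inf (fun t => exists q, F q /\ t = q x) (r x).
Proof.
  intros [q0 h0] hs hd.
  destruct (functional_choice
    (fun x m => is_inf (fun t => exists q, F q /\ t = q x) m)) as [r hr].
  - intros x; apply inf_exists; [eauto|].
    intros t [q [hq ->]]; apply seminorm_nonneg; auto.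
  - exists r; split; [|exact hr].
    assert (low : forall q x, F q -> r x <= q x).
    { intros q x hq; apply (hr x); eauto. }
    assert (app : forall x e, 0 < e -> exists q, F q /\ q x < r x + e).
    { intros x e he; destruct (hr x) as [_ [_ h]].
      destruct (h e he) as [t [[q [hq ->]] ht]]; eauto. }
    apply seminorm_of_le.
    + intros x; apply (hr x).
    + intros x y; apply le_of_forall_eps; intros e he.
      destruct (app x (e / 2)) as [q1 [f1 h1]]; [lra|].
      destruct (app y (e / 2)) as [q2 [f2 h2]]; [lra|].
      destruct (hd q1 q2 f1 f2) as [q3 [f3 [l1 l2]]].
      pose proof (low q3 (add A x y) f3) as h3.
      destruct (hs q3 f3) as [ht _]; specialize (ht x y).
      specialize (l1 x); specialize (l2 y); lra.
    + intros a x; apply le_of_forall_eps; intros e he.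
      pose proof (Cmod_nonneg a) as ha.
      destruct (app x (e / (Cmod a + 1))) as [q1 [f1 h1]].
      { apply Rdiv_lt_0_compat; lra. }
      pose proof (low q1 (scal A a x) f1) as h3.
      destruct (hs q1 f1) as [_ hsc]; rewrite hsc in h3.
      assert (Cmod a * (e / (Cmod a + 1)) <= e).
      { apply Rmult_le_reg_r with (Cmod a + 1); [lra|].
        replace (Cmod a * (e / (Cmod a + 1)) * (Cmod a + 1)) with (Cmod a * e)
          by (field; lra); nra. }
      nra.
    + apply Rle_antisym; [|apply (hr (zero A))].
      rewrite <- (seminorm_0 q0 (hs q0 h0)); apply low, h0.
Qed.

(** The square may be compared with a different member of the family, because in the sequence
    [q (y a^n) / (q a)^n] squaring [y] doubles the index. *)
Lemma directed_inf_uniform (F : (A -> R) -> Prop) (r : A -> R) :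
  (forall q, F q -> seminorm q) ->
  (forall q x, F q -> exists q', F q' /\ q' (mul A x x) <= q x ^ 2) ->
  (forall q x, F q -> exists q', F q' /\ q' x ^ 2 <= q (mul A x x)) ->
  (forall x, is_inf (fun t => exists q, F q /\ t = q x) (r x)) ->
  uniform r.
Proof.
  intros hF h1 h2 hr x.
  assert (low : forall q x, F q -> r x <= q x).
  { intros q y hq; apply (hr y); eauto. }
  assert (app : forall x e, 0 < e -> exists q, F q /\ q x < r x + e).
  { intros y e he; destruct (hr y) as [_ [_ h]].
    destruct (h e he) as [t [[q [hq ->]] ht]]; eauto. }
  assert (pos : forall x, 0 <= r x) by (intros y; apply (hr y)).
  apply Rle_antisym.
  - replace (r x ^ 2) with (r x * r x) by ring.
    apply le_mul_of_lt; try apply pos; intros s t hs ht.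
    destruct (app x (Rmin s t - r x)) as [q [fq hq]].
    { enough (r x < Rmin s t) by lra; apply Rmin_glb_lt; assumption. }
    destruct (h1 q x fq) as [q' [fq' hq']].
    pose proof (low q' (mul A x x) fq'); pose proof (seminorm_nonneg q (hF q fq) x).
    pose proof (Rmin_l s t); pose proof (Rmin_r s t).
    nra.
  - apply le_of_forall_eps; intros e he.
    destruct (app (mul A x x) e he) as [q [fq hq]].
    destruct (h2 q x fq) as [q' [fq' hq']].
    pose proof (low q' x fq'); pose proof (pos x); nra.
Qed.

(** The identity 4xy = (x + y)^2 - (x - y)^2 gives q(xy) <= 2 on the unit ball, hence the inequality
    with a factor 2 after scaling. Applying this to x^(2^n) and y^(2^n) and comparing powers removes
    the factor. The strict bounds [s], [t] avoid dividing by a zero value of [q]. *)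
Lemma uniform_submultiplicative q : seminorm q -> uniform q ->
  forall x y, q (mul A x y) <= q x * q y.
Proof.
  intros sq uq.
  assert (step1 : forall x y, q x <= 1 -> q y <= 1 -> q (mul A x y) <= 2).
  { intros x y hx hy.
    assert (e : mul A (cst (4, 0)) (mul A x y)
      = asub A (mul A (add A x y) (add A x y)) (mul A (asub A x y) (asub A x y))).
    { replace (4, 0) with (Cadd (Cadd C1 C1) (Cadd C1 C1)).
      - rewrite !cst_add, !cst_1; ring.
      - unfold Cadd, C1; cbn; f_equal; ring. }
    apply (f_equal q) in e; rewrite seminorm_scal, Cmod_real, Rabs_pos_eq in e
      by (assumption || lra).
    pose proof (seminorm_sub q sq (mul A (add A x y) (add A x y))
                  (mul A (asub A x y) (asub A x y))) as h.
    rewrite !uq in h.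
    pose proof (seminorm_nonneg q sq (add A x y)).
    pose proof (seminorm_nonneg q sq (asub A x y)).
    pose proof (proj1 sq x y); pose proof (seminorm_sub q sq x y); nra. }
  assert (step2 : forall x y s t, 0 < s -> 0 < t -> q x <= s -> q y <= t ->
    q (mul A x y) <= 2 * (s * t)).
  { intros x y s t hs ht hx hy.
    assert (norm : forall z u, 0 < u -> q z <= u -> q (mul A (cst (/ u, 0)) z) <= 1).
    { intros z u hu hz; pose proof (Rinv_0_lt_compat u hu).
      rewrite seminorm_scal, Cmod_real, Rabs_pos_eq by (assumption || lra).
      rewrite <- (Rinv_l u) by lra; apply Rmult_le_compat_l; lra. }
    pose proof (step1 _ _ (norm x s hs hx) (norm y t ht hy)) as h.
    replace (mul A (mul A (cst (/ s, 0)) x) (mul A (cst (/ t, 0)) y))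
      with (mul A (cst (/ s, 0)) (mul A (cst (/ t, 0)) (mul A x y))) in h by ring.
    pose proof (Rinv_0_lt_compat s hs); pose proof (Rinv_0_lt_compat t ht).
    rewrite !seminorm_scal, !Cmod_real, !Rabs_pos_eq in h by (assumption || lra).
    replace (q (mul A x y)) with (s * t * (/ s * (/ t * q (mul A x y))))
      by (field; lra).
    apply (Rmult_le_compat_l (s * t)) in h; nra. }
  assert (step3 : forall n x y s t, 0 < s -> 0 < t -> q x <= s -> q y <= t ->
    q (mul A x y) ^ (2 ^ n) <= 2 * (s * t) ^ (2 ^ n)).
  { induction n as [|n IH]; intros x y s t hs ht hx hy.
    - rewrite !pow_1; auto.
    - rewrite Nat.pow_succ_r', !pow_mult, <- uq.
      replace (mul A (mul A x y) (mul A x y))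
        with (mul A (mul A x x) (mul A y y)) by ring.
      replace ((s * t) ^ 2) with (s ^ 2 * t ^ 2) by ring.
      pose proof (seminorm_nonneg q sq x); pose proof (seminorm_nonneg q sq y).
      apply IH; rewrite ?uq; nra. }
  intros x y; apply le_mul_of_lt; try apply seminorm_nonneg, sq.
  intros s t hs ht; pose proof (seminorm_nonneg q sq x).
  pose proof (seminorm_nonneg q sq y).
  apply le_of_pow_le with 2; [apply seminorm_nonneg, sq|nra|intros n].
  exists (2 ^ n)%nat; split; [apply Nat.lt_le_incl, Nat.pow_gt_lin_r; lia|].
  apply step3; lra.
Qed.

Section Uniform.
Context (q : A -> R) (sq : seminorm q) (uq : uniform q).

Lemma uniform_one x : 0 < q x -> q (one A) = 1.
Proof.
  intros hx; pose proof (uniform_submultiplicative q sq uq (one A) x) as h.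
  replace (mul A (one A) x) with x in h by ring.
  pose proof (uq (one A)) as e.
  replace (mul A (one A) (one A)) with (one A) in e by ring; nra.
Qed.

Lemma uniform_pw_le a x n : 0 < q x -> q (pw a n) <= q a ^ n.
Proof.
  intros hx; induction n as [|n IH]; cbn.
  - right; apply (uniform_one x hx).
  - apply Rle_trans with (1 := uniform_submultiplicative q sq uq _ _).
    apply Rmult_le_compat_l; [apply seminorm_nonneg, sq|exact IH].
Qed.

(** Equality is clear for exponents that are powers of two. Writing 2^n = n + (2^n - n), a strict
    inequality at [n] would contradict equality at 2^n. *)
Lemma uniform_pw a n : 0 < q a -> q (pw a n) = q a ^ n.
Proof.
  intros ha; apply Rle_antisym; [apply uniform_pw_le with a, ha|].
  assert (e : forall k, q (pw a (2 ^ k)) = q a ^ (2 ^ k)).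
  { induction k as [|k IH].
    - cbn; replace (mul A a (one A)) with a by ring; ring.
    - rewrite Nat.pow_succ_r', pw_twice, uq, IH.
      rewrite Nat.mul_comm, pow_mult; reflexivity. }
  assert (hn : (2 ^ n = n + (2 ^ n - n))%nat).
  { pose proof (Nat.pow_gt_lin_r 2 n); lia. }
  specialize (e n); rewrite hn, pw_add, pow_add in e.
  pose proof (uniform_submultiplicative q sq uq (pw a n) (pw a (2 ^ n - n))) as h.
  rewrite e in h.
  pose proof (uniform_pw_le a a (2 ^ n - n) ha) as h'.
  pose proof (pow_lt (q a) (2 ^ n - n) ha) as h''.
  apply Rmult_le_reg_r with (1 := h'').
  apply Rle_trans with (1 := h); apply Rmult_le_compat_l; [|exact h'].
  apply seminorm_nonneg, sq.
Qed.

(* The seminorm [inf_n q (y a^n) / q(a)^n] is uniform, lies below [q] and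
   turns multiplication by [a] into multiplication by [q a]; minimality forces
   it to equal [q]. *)
Lemma minimal_uniform_mul x a :
  (forall q', seminorm q' -> uniform q' -> (forall y, q' y <= q y) ->
     q' x = q x -> forall y, q' y = q y) ->
  0 < q a -> (forall n, q (mul A x (pw a n)) = q x * q a ^ n) ->
  forall y, q (mul A y a) = q y * q a.
Proof.
  intros min ha hx.
  pose (u := fun n y => q (mul A y (pw a n)) / q a ^ n).
  assert (pos : forall n, 0 < q a ^ n) by (intros n; apply pow_lt, ha).
  assert (su : forall n, seminorm (u n)).
  { intros n; specialize (pos n); split; unfold u.
    - intros y z.
      replace (mul A (add A y z) (pw a n))
        with (add A (mul A y (pw a n)) (mul A z (pw a n))) by ring.
      unfold Rdiv; rewrite <- Rmult_plus_distr_r; apply Rmult_le_compat_r.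
      + left; apply Rinv_0_lt_compat, pos.
      + apply sq.
    - intros c y; rewrite scal_cst.
      replace (mul A (mul A (cst c) y) (pw a n))
        with (mul A (cst c) (mul A y (pw a n))) by ring.
      rewrite seminorm_scal by exact sq; field; lra. }
  assert (decr : forall n m y, u (n + m)%nat y <= u n y).
  { intros n m y; unfold u; rewrite pw_add, pow_add.
    replace (mul A y (mul A (pw a n) (pw a m)))
      with (mul A (mul A y (pw a n)) (pw a m)) by ring.
    pose proof (uniform_submultiplicative q sq uq (mul A y (pw a n)) (pw a m)) as h.
    rewrite uniform_pw in h by exact ha.
    apply Rmult_le_reg_r with (q a ^ n * q a ^ m).
    { apply Rmult_lt_0_compat; apply pos. }
    pose proof (pos n); pose proof (pos m).
    replace (q (mul A (mul A y (pw a n)) (pw a m)) / (q a ^ n * q a ^ m)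
              * (q a ^ n * q a ^ m))
      with (q (mul A (mul A y (pw a n)) (pw a m))) by (field; lra).
    replace (q (mul A y (pw a n)) / q a ^ n * (q a ^ n * q a ^ m))
      with (q (mul A y (pw a n)) * q a ^ m) by (field; lra).
    exact h. }
  assert (sqr : forall n y, u (2 * n)%nat (mul A y y) = u n y ^ 2).
  { intros n y; unfold u; rewrite pw_twice, Nat.mul_comm, pow_mult.
    replace (mul A (mul A y y) (mul A (pw a n) (pw a n)))
      with (mul A (mul A y (pw a n)) (mul A y (pw a n))) by ring.
    rewrite uq; field; specialize (pos n); lra. }
  destruct (directed_inf_seminorm (fun f => exists n, f = u n)) as [r [sr hr]].
  - exists (u O), O; reflexivity.
  - intros f [n ->]; apply su.
  - intros f1 f2 [n ->] [k ->]; exists (u (n + k)%nat); split; [eauto|split]; intros y.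
    + apply decr.
    + rewrite Nat.add_comm; apply decr.
  - assert (ur : uniform r).
    { apply directed_inf_uniform with (4 := hr).
      - intros f [n ->]; apply su.
      - intros f y [n ->]; exists (u (2 * n)%nat); split; [eauto|right; apply sqr].
      - intros f y [n ->]; exists (u n); split; [eauto|].
        rewrite <- sqr; replace (2 * n)%nat with (n + n)%nat by lia; apply decr. }
    assert (low : forall n y, r y <= u n y).
    { intros n y; apply (hr y); eauto. }
    assert (eq : forall y, r y = q y).
    { apply min; [exact sr|exact ur| |].
      - intros y; apply Rle_trans with (1 := low O y); unfold u; cbn.
        replace (mul A y (one A)) with y by ring; lra.
      (* By [hx] every [u n] takes the value [q x] at [x], so the infimum does too. *)
      - destruct (hr x) as [_ [_ h]]; apply Rle_antisym.
        + apply Rle_trans with (1 := low O x); unfold u; cbn.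
          replace (mul A x (one A)) with x by ring; lra.
        + apply le_of_forall_eps; intros e he.
          destruct (h e he) as [t [[f [[n ->] ->]] ht]].
          unfold u in ht; rewrite hx in ht; left; specialize (pos n).
          replace (q x * q a ^ n / q a ^ n) with (q x) in ht by (field; lra).
          exact ht. }
    intros y; apply Rle_antisym; [apply uniform_submultiplicative; assumption|].
    rewrite <- (eq (mul A y a)); destruct (hr (mul A y a)) as [_ [_ h]].
    apply le_of_forall_eps; intros e he.
    destruct (h e he) as [t [[f [[n ->] ->]] ht]].
    apply Rlt_le, Rle_lt_trans with (2 := ht).
    (* Since [u (S n) y * q a] is [u n] at [y a], the number [r y * q a] is a lower bound for all
       [u n] at [y a]. *)
    rewrite <- (eq y); pose proof (low (S n) y) as h'.
    apply (Rmult_le_compat_r (q a)) in h'; [|lra].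
    apply Rle_trans with (1 := h'); right; unfold u; cbn.
    replace (mul A (mul A y a) (pw a n)) with (mul A y (mul A a (pw a n))) by ring.
    field; specialize (pos n); lra.
Qed.

End Uniform.

Lemma minimal_uniform_exists p x : seminorm p -> uniform p ->
  exists q, seminorm q /\ uniform q /\ (forall y, q y <= p y) /\ q x = p x /\
    forall q', seminorm q' -> uniform q' -> (forall y, q' y <= q y) ->
      q' x = q x -> forall y, q' y = q y.
Proof.
  intros sp up.
  pose (good := fun q => seminorm q /\ uniform q /\ (forall y, q y <= p y) /\ q x = p x).
  assert (gp : good p) by (repeat split; try apply sp; auto; intros y; lra).
  (* The order is reversed, so that a maximal element for Zorn's lemma is a minimal seminorm and a
     chain is bounded by its pointwise infimum. *)
  pose (le := fun s t : {q | good q} =>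
    boolp.asbool (forall y, proj1_sig t y <= proj1_sig s y)).
  destruct (@classical_sets.ZL_preorder {q | good q} (exist _ p gp) le)
    as [[q gq] max].
  - intros t; apply boolp.asboolT; intros y; lra.
  - intros r s t h1 h2; apply boolp.asboolT; intros y.
    apply Rle_trans with (proj1_sig s y); [apply (boolp.asboolW h2)|apply (boolp.asboolW h1)].
  - intros S tot.
    destruct (classic (exists s, S s)) as [[s0 hs0]|none].
    2: { exists (exist _ p gp); intros s hs; exfalso; apply none; eauto. }
    destruct (directed_inf_seminorm (fun f => exists s, S s /\ f = proj1_sig s))
      as [r [sr hr]].
    + eauto.
    + intros f [[g hg] [_ ->]]; apply hg.
    + intros f1 f2 [s1 [h1 ->]] [s2 [h2 ->]].
      destruct (tot s1 s2 h1 h2) as [h|h]; apply boolp.asboolW in h.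
      * exists (proj1_sig s2); split; [eauto|split; intros y; auto; lra].
      * exists (proj1_sig s1); split; [eauto|split; intros y; auto; lra].
    + assert (ur : uniform r).
      { apply directed_inf_uniform with (4 := hr).
        - intros f [[g hg] [_ ->]]; apply hg.
        - intros f y [[g hg] [hS ->]]; exists g; split; [exists (exist _ g hg); auto|].
          right; apply hg.
        - intros f y [[g hg] [hS ->]]; exists g; split; [exists (exist _ g hg); auto|].
          right; symmetry; apply hg. }
      assert (low : forall s y, S s -> r y <= proj1_sig s y).
      { intros s y hs; apply (hr y); eauto. }
      assert (gr : good r).
      { split; [exact sr|split; [exact ur|split]].
        - intros y; apply Rle_trans with (1 := low s0 y hs0).
          destruct s0 as [g hg]; apply hg.
        - destruct (hr x) as [_ [_ h]]; apply Rle_antisym.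
          + apply Rle_trans with (1 := low s0 x hs0).
            destruct (proj2_sig s0) as [_ [_ [_ hg]]]; lra.
          + apply le_of_forall_eps; intros e he.
            destruct (h e he) as [t [[f [[s [_ ->]] ->]] ht]].
            destruct (proj2_sig s) as [_ [_ [_ hg]]]; lra. }
      exists (exist _ r gr); intros s hs; apply boolp.asboolT; intros y.
      apply low, hs.
  - exists q; pose proof gq as [sq [uq [lq xq]]].
    split; [exact sq|split; [exact uq|split; [exact lq|split; [exact xq|]]]].
    intros q' sq' uq' lq' xq' y.
    assert (gq' : good q').
    { split; [exact sq'|split; [exact uq'|split; [|lra]]].
      intros z; apply Rle_trans with (q z); auto. }
    apply Rle_antisym; [apply lq'|].
    specialize (max (exist _ q' gq')).
    apply (boolp.asboolW (max (boolp.asboolT lq'))).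
Qed.

(** Minimality is used twice. First with a = x, where the condition on powers is [uniform_pw]; this
    makes multiplication by [x] multiplicative for [q]. That supplies the condition for every [z]
    with q z > 0; if q z = 0, submultiplicativity is enough. *)
Lemma multiplicative_seminorm_exists p x : seminorm p -> uniform p -> 0 < p x ->
  exists q, seminorm q /\ (forall y z, q (mul A y z) = q y * q z) /\
    (forall y, q y <= p y) /\ q x = p x /\ q (one A) = 1.
Proof.
  intros sp up hx.
  destruct (minimal_uniform_exists p x sp up) as [q [sq [uq [lq [xq min]]]]].
  rewrite <- xq in hx.
  assert (mx : forall y, q (mul A y x) = q y * q x).
  { apply minimal_uniform_mul with x; auto.
    intros n; change (mul A x (pw x n)) with (pw x (S n)).
    apply (uniform_pw q sq uq x (S n) hx). }
  exists q; split; [exact sq|split; [|split; [exact lq|split; [exact xq|]]]].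
  - intros y z; destruct (seminorm_nonneg q sq z) as [hz|hz].
    + apply minimal_uniform_mul with x; auto.
      intros n; replace (mul A x (pw z n)) with (mul A (pw z n) x) by ring.
      rewrite mx, uniform_pw by assumption; ring.
    + pose proof (uniform_submultiplicative q sq uq y z) as h.
      pose proof (seminorm_nonneg q sq (mul A y z)).
      rewrite <- hz, Rmult_0_r in *; lra.
  - apply uniform_one with x; assumption.
Qed.

(** * Gelfand-Mazur for multiplicative seminorms *)

Section GelfandMazur.
Context (q : A -> R) (sq : seminorm q).
Context (mq : forall y z, q (mul A y z) = q y * q z) (q1 : q (one A) = 1).

Lemma q_cst a : q (cst a) = Cmod a.
Proof.
  replace (cst a) with (mul A (cst a) (one A)) by ring.
  rewrite seminorm_scal, q1 by exact sq; ring.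
Qed.

Lemma q_pw x n : q (pw x n) = q x ^ n.
Proof. induction n as [|n IH]; cbn; [exact q1|rewrite mq, IH; reflexivity]. Qed.

Lemma pw_cst a n : exists b, pw (cst a) n = cst b.
Proof.
  induction n as [|n [b IH]]; cbn.
  - exists C1; symmetry; apply cst_1.
  - exists (Cmul a b); rewrite IH, cst_mul; reflexivity.
Qed.

Section Shift.
Context (m : R) (m0 : 0 < m).

Definition far (z : A) : Prop := forall a, m <= q (asub A z (cst a)).

(** Taking w = v^2, the difference z^(2^(k+1)) - w splits as (z^(2^k) - v)(z^(2^k) + v), and both
    factors are differences with scalars. This is where square roots of complex numbers enter. *)
Lemma far_pw z : far z ->
  forall k w, m ^ (2 ^ k) <= q (asub A (pw z (2 ^ k)) (cst w)).
Proof.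
  intros hz; induction k as [|k IH]; intros w.
  - cbn; replace (mul A z (one A)) with z by ring; rewrite Rmult_1_r; apply hz.
  - destruct (Csqrt_exists w) as [v <-].
    replace (asub A (pw z (2 ^ S k)) (cst (Cmul v v)))
      with (mul A (asub A (pw z (2 ^ k)) (cst v)) (asub A (pw z (2 ^ k)) (cst (Copp v)))).
    + rewrite mq, Nat.pow_succ_r'; replace (2 * 2 ^ k)%nat with (2 ^ k + 2 ^ k)%nat by lia.
      rewrite pow_add; pose proof (pow_lt m (2 ^ k) m0).
      apply Rmult_le_compat; try lra; apply IH.
    + rewrite Nat.pow_succ_r', pw_twice, cst_mul, cst_opp; ring.
Qed.

(* [z^(2^k) - b^(2^k)] is [z - b] times the product of the [z^(2^j) + b^(2^j)]
   for [j < k], each of norm at least [m^(2^j)] because [-b^(2^j)] is a scalar. *)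
Lemma far_factor z b : far z -> forall k,
  q (asub A z (cst b)) * m ^ (2 ^ k)
    <= m * q (asub A (pw z (2 ^ k)) (pw (cst b) (2 ^ k))).
Proof.
  intros hz; induction k as [|k IH].
  - cbn; replace (mul A z (one A)) with z by ring.
    replace (mul A (cst b) (one A)) with (cst b) by ring; lra.
  - rewrite Nat.pow_succ_r', !pw_twice.
    destruct (pw_cst b (2 ^ k)) as [c e]; rewrite e in *.
    replace (asub A (mul A (pw z (2 ^ k)) (pw z (2 ^ k))) (mul A (cst c) (cst c)))
      with (mul A (asub A (pw z (2 ^ k)) (cst c)) (asub A (pw z (2 ^ k)) (cst (Copp c))))
      by (rewrite cst_opp; ring).
    rewrite mq; replace (2 * 2 ^ k)%nat with (2 ^ k + 2 ^ k)%nat by lia.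
    rewrite pow_add, <- !Rmult_assoc; pose proof (pow_lt m (2 ^ k) m0).
    pose proof (seminorm_nonneg q sq (asub A z (cst b))).
    apply Rmult_le_compat; [nra|lra|exact IH|apply far_pw, hz].
Qed.

(** For N = 2^k, [far_factor] bounds q(z - m/2) by m (q(z)^N + (m/2)^N) / m^N, which is at most m
    ((1 + e)^N + 2^(-N)). First [k] is taken so large that 2^(-N) < d/2, then [e] so small that (1 +
    e)^N <= 1 + d/2. *)
Lemma far_step d : 0 < d -> exists e, 0 < e /\ forall z, far z ->
  q z <= m * (1 + e) -> q (asub A z (cst (m / 2, 0))) <= m * (1 + d).
Proof.
  intros hd.
  destruct (pow_lt_1_zero (1 / 2)) with (y := d / 2) as [k hk].
  { rewrite Rabs_pos_eq; lra. }
  { lra. }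
  specialize (hk (2 ^ k)%nat (Nat.lt_le_incl _ _ (Nat.pow_gt_lin_r 2 k ltac:(lia)))).
  set (N := (2 ^ k)%nat) in *.
  destruct (pow_near_one N (d / 2)) as [e [he hN]]; [lra|].
  exists e; split; [exact he|intros z hz hq].
  pose proof (far_factor z (m / 2, 0) hz k) as h; fold N in h.
  pose proof (seminorm_sub q sq (pw z N) (pw (cst (m / 2, 0)) N)) as h'.
  rewrite !q_pw, q_cst, Cmod_real, Rabs_pos_eq in h' by lra.
  assert (q z ^ N <= m ^ N * (1 + d / 2)).
  { apply Rle_trans with ((m * (1 + e)) ^ N).
    - apply pow_incr; split; [apply seminorm_nonneg, sq|exact hq].
    - rewrite Rpow_mult_distr; apply Rmult_le_compat_l; [|exact hN].
      left; apply pow_lt, m0. }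
  assert ((m / 2) ^ N <= m ^ N * (d / 2)).
  { replace (m / 2) with (m * (1 / 2)) by field; rewrite Rpow_mult_distr.
    apply Rmult_le_compat_l; [left; apply pow_lt, m0|].
    apply Rle_trans with (1 := Rle_abs _); lra. }
  pose proof (pow_lt m N m0); apply Rmult_le_reg_r with (m ^ N); [assumption|].
  apply Rle_trans with (1 := h).
  replace (m * (1 + d) * m ^ N)
    with (m * (m ^ N * (1 + d / 2) + m ^ N * (d / 2))) by field.
  apply Rmult_le_compat_l; lra.
Qed.

Lemma far_shift z a : far z -> far (asub A z (cst a)).
Proof.
  intros hz b.
  replace (asub A (asub A z (cst a)) (cst b)) with (asub A z (cst (Cadd a b)))
    by (rewrite cst_add; ring); apply hz.
Qed.

(** Each step worsens the tolerance, so tolerances are chosen backwards from the last step.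
    Translation by a scalar preserves [far], so the steps can be chained. *)
Lemma far_steps j : forall d, 0 < d -> exists e, 0 < e /\ forall z, far z ->
  q z <= m * (1 + e) -> q (asub A z (cst (INR j * (m / 2), 0))) <= m * (1 + d).
Proof.
  induction j as [|j IH]; intros d hd.
  - exists d; split; [exact hd|intros z _ hz].
    replace (INR 0 * (m / 2), 0) with C0 by (unfold C0; cbn; f_equal; ring).
    rewrite cst_0; replace (asub A z (zero A)) with z by ring; exact hz.
  - destruct (far_step d hd) as [d' [hd' h1]]; destruct (IH d' hd') as [e [he h2]].
    exists e; split; [exact he|intros z hz hq].
    replace (asub A z (cst (INR (S j) * (m / 2), 0)))
      with (asub A (asub A z (cst (INR j * (m / 2), 0))) (cst (m / 2, 0))).
    + apply h1; [apply far_shift|apply h2]; assumption.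
    + replace (INR (S j) * (m / 2), 0) with (Cadd (INR j * (m / 2), 0) (m / 2, 0)).
      * rewrite cst_add; ring.
      * rewrite S_INR; unfold Cadd; cbn; f_equal; ring.
Qed.

(* Otherwise nine steps of length [m / 2] would move an almost closest point
   by [9 m / 2] while keeping its norm below [2 m]. *)
Lemma not_far_of_inf y :
  (forall e, 0 < e -> exists a, q (asub A y (cst a)) <= m + e) -> ~ far y.
Proof.
  intros hinf hy; destruct (far_steps 9 1 ltac:(lra)) as [e [he h]].
  (* The cap 1 keeps the starting point at norm at most 2m; with the end point also at norm at most
     2m, a difference of 9m/2 is impossible. *)
  pose (e' := Rmin e 1); assert (he' : 0 < e') by (apply Rmin_glb_lt; lra).
  assert (e' <= e) by apply Rmin_l; assert (e' <= 1) by apply Rmin_r.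
  destruct (hinf (m * e')) as [a ha]; [nra|].
  specialize (h _ (far_shift y a hy)).
  assert (ha' : q (asub A y (cst a)) <= m * (1 + e)) by nra.
  specialize (h ha').
  pose proof (seminorm_sub q sq (asub A y (cst a))
    (asub A (asub A y (cst a)) (cst (INR 9 * (m / 2), 0)))) as h'.
  replace (asub A (asub A y (cst a)) (asub A (asub A y (cst a)) (cst (INR 9 * (m / 2), 0))))
    with (cst (INR 9 * (m / 2), 0)) in h' by ring.
  cbn [INR] in h'; rewrite q_cst, Cmod_real, Rabs_pos_eq in h' by lra.
  cbn [INR] in h; nra.
Qed.

End Shift.

(** The distance of [y] from the scalars cannot be positive by [not_far_of_inf]. Scalars that nearly
    attain the distance 0 are close to each other, and completeness gives one that attains it. *)
Lemma gelfand_mazur y : exists a, q (asub A y (cst a)) = 0.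
Proof.
  destruct (inf_exists (fun t => exists a, t = q (asub A y (cst a)))) as [m [m0 [m1 m2]]].
  - exists (q (asub A y (cst C0))), C0; reflexivity.
  - intros t [a ->]; apply seminorm_nonneg, sq.
  - assert (hm : m = 0).
    { destruct m0 as [m0|]; [exfalso|auto].
      apply (not_far_of_inf m m0 y).
      - intros e he; destruct (m2 e he) as [t [[a ->] ht]]; exists a; lra.
      - intros a; apply m1; eauto. }
    subst m.
    assert (app : forall e, 0 < e -> exists a, q (asub A y (cst a)) <= e).
    { intros e he; destruct (m2 e he) as [t [[a ->] ht]]; exists a; lra. }
    destruct (C_complete (fun t a => q (asub A y (cst a)) <= t)) as [w hw].
    + destruct (app 1 ltac:(lra)); eauto.
    + intros t t' a b ha hb; rewrite <- q_cst, cst_sub.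
      replace (asub A (cst a) (cst b))
        with (asub A (asub A y (cst b)) (asub A y (cst a))) by ring.
      pose proof (seminorm_sub q sq (asub A y (cst b)) (asub A y (cst a))); lra.
    + exists w; apply Rle_antisym; [|apply seminorm_nonneg, sq].
      apply le_of_forall_eps; intros e he.
      (* The limit [w] is only known to be within 2 (e/3) of [a], hence the third. *)
      destruct (app (e / 3)) as [a ha]; [lra|]; pose proof (hw _ _ ha) as h.
      rewrite <- q_cst, cst_sub in h.
      replace (asub A y (cst w))
        with (asub A (asub A y (cst a)) (asub A (cst w) (cst a))) by ring.
      pose proof (seminorm_sub q sq (asub A y (cst a)) (asub A (cst w) (cst a))); lra.
Qed.

(** The scalar congruent to [y] modulo the kernel of [q] is unique, because [q] is the modulus on
    scalars. Each law of a character then follows by exhibiting the expected value as such a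
    scalar. *)
Lemma character_of_multiplicative_seminorm :
  exists g, mlf A whole g /\ forall y, Cmod (g y) = q y.
Proof.
  destruct (functional_choice _ gelfand_mazur) as [g hg].
  assert (uniq : forall y a, q (asub A y (cst a)) = 0 -> g y = a).
  { intros y a ha; apply eq_of_Cmod_small; intros e he.
    rewrite <- q_cst, cst_sub.
    replace (asub A (cst (g y)) (cst a))
      with (asub A (asub A y (cst a)) (asub A y (cst (g y)))) by ring.
    pose proof (seminorm_sub q sq (asub A y (cst a)) (asub A y (cst (g y)))) as h.
    rewrite ha, hg in h; lra. }
  assert (small : forall z, q z <= 0 -> q z = 0).
  { intros z hz; apply Rle_antisym; [exact hz|apply seminorm_nonneg, sq]. }
  assert (abs : forall y, Cmod (g y) = q y).
  { intros y; rewrite <- q_cst; apply Rle_antisym.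
    - pose proof (seminorm_le_sub q sq (cst (g y)) y) as h.
      rewrite seminorm_sub_sym, hg in h by exact sq; lra.
    - pose proof (seminorm_le_sub q sq y (cst (g y))) as h; rewrite hg in h; lra. }
  exists g; split; [|exact abs]; split; [|split; [|split]].
  - intros x y _ _; apply uniq, small; rewrite cst_add.
    replace (asub A (add A x y) (add A (cst (g x)) (cst (g y))))
      with (add A (asub A x (cst (g x))) (asub A y (cst (g y)))) by ring.
    apply Rle_trans with (1 := proj1 sq _ _); rewrite !hg; lra.
  - intros a x _; apply uniq; rewrite scal_cst, cst_mul.
    replace (asub A (mul A (cst a) x) (mul A (cst a) (cst (g x))))
      with (mul A (cst a) (asub A x (cst (g x)))) by ring.
    rewrite mq, hg; ring.
  - intros x y _ _; apply uniq, small; rewrite cst_mul.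
    replace (asub A (mul A x y) (mul A (cst (g x)) (cst (g y))))
      with (add A (mul A x (asub A y (cst (g y)))) (mul A (cst (g y)) (asub A x (cst (g x)))))
      by ring.
    apply Rle_trans with (1 := proj1 sq _ _); rewrite !mq, !hg; lra.
  - exists (one A); split; [exact I|intros e].
    pose proof (abs (one A)) as h; rewrite e, Cmod_C0, q1 in h; lra.
Qed.

End GelfandMazur.

Lemma uniform_character p x : seminorm p -> uniform p -> 0 < p x ->
  exists g, mlf A whole g /\ (forall y, Cmod (g y) <= p y) /\ Cmod (g x) = p x.
Proof.
  intros sp up hx.
  destruct (multiplicative_seminorm_exists p x sp up hx) as [q [sq [mq [lq [xq q1]]]]].
  destruct (character_of_multiplicative_seminorm q sq mq q1) as [g [hg abs]].
  exists g; split; [exact hg|split].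
  - intros y; rewrite abs; apply lq.
  - rewrite abs; exact xq.
Qed.

(** * Spectral radius modulo an ideal *)

Section SpectralSeminorm.
Context (P : A -> R) (sP : seminorm P).
Context (mP : forall x y, P (mul A x y) <= P x * P y).
Context (invP : forall u, P u < 1 -> exists v, mul A (asub A (one A) u) v = one A).
Context (I : A -> Prop) (idI : ideal_of A whole I) (properI : ~ I (one A)).

(** A bound on the quotient seminorm modulo [I], kept as a relation so that no quotient algebra has
    to be formed. *)
Definition near_ideal (x : A) (t : R) : Prop := exists i, I i /\ P (asub A x i) <= t.

Lemma near_ideal_le x t t' : near_ideal x t -> t <= t' -> near_ideal x t'.
Proof. intros [i [hi h]] ht; exists i; split; [exact hi|lra]. Qed.

Lemma near_ideal_self x : near_ideal x (P x).
Proof.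
  exists (zero A); split; [apply idI|].
  replace (asub A x (zero A)) with x by ring; lra.
Qed.

Lemma near_ideal_add x y t u :
  near_ideal x t -> near_ideal y u -> near_ideal (add A x y) (t + u).
Proof.
  intros [i [hi h]] [j [hj h']]; exists (add A i j); split; [apply idI; assumption|].
  replace (asub A (add A x y) (add A i j)) with (add A (asub A x i) (asub A y j)) by ring.
  apply Rle_trans with (1 := proj1 sP _ _); lra.
Qed.

Lemma near_ideal_mul x y t u :
  near_ideal x t -> near_ideal y u -> near_ideal (mul A x y) (t * u).
Proof.
  intros [i [hi h]] [j [hj h']].
  destruct idI as [_ [_ [Iadd [_ Imul]]]].
  (* Chosen so that subtracting it from x y leaves (x - i)(y - j). *)
  exists (add A (mul A y i) (mul A (asub A x i) j)); split.
  - apply Iadd; apply Imul; unfold whole; auto.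
  - replace (asub A (mul A x y) (add A (mul A y i) (mul A (asub A x i) j)))
      with (mul A (asub A x i) (asub A y j)) by ring.
    apply Rle_trans with (1 := mP _ _).
    apply Rmult_le_compat; auto; apply seminorm_nonneg, sP.
Qed.

(** Using [near_ideal_mul] with the bound [P (cst a)] would cost a factor P(1) for each power;
    homogeneity gives the exact factor |a|. *)
Lemma near_ideal_pw_cst a n x t :
  near_ideal x t -> near_ideal (mul A (pw (cst a) n) x) (Cmod a ^ n * t).
Proof.
  destruct idI as [_ [_ [_ [_ Imul]]]].
  intros hx; induction n as [|n [i [hi h]]]; cbn.
  - replace (mul A (one A) x) with x by ring; rewrite Rmult_1_l; exact hx.
  - exists (mul A (cst a) i); split; [apply Imul; unfold whole; auto|].
    replace (asub A (mul A (mul A (cst a) (pw (cst a) n)) x) (mul A (cst a) i))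
      with (mul A (cst a) (asub A (mul A (pw (cst a) n) x) i)) by ring.
    rewrite seminorm_scal, Rmult_assoc by exact sP.
    apply Rmult_le_compat_l; [apply Cmod_nonneg|exact h].
Qed.

(** An element i of [I] with P(1 - i) < 1 would be invertible, since i = 1 - (1 - i), and [I] would
    not be proper. *)
Lemma near_ideal_one t : near_ideal (one A) t -> 1 <= t.
Proof.
  intros [i [hi h]]; destruct (Rle_or_lt 1 t) as [|hlt]; [assumption|exfalso].
  destruct (invP (asub A (one A) i)) as [v hv]; [lra|].
  apply properI; rewrite <- hv.
  replace (mul A (asub A (one A) (asub A (one A) i)) v) with (mul A v i) by ring.
  apply idI; [exact Logic.I|exact hi].
Qed.

(* [s] is an upper bound for the spectral radius of the class of [x] modulo [I]. *)
Definition growth (x : A) (s : R) : Prop :=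
  0 < s /\ exists M, 0 <= M /\ forall n, near_ideal (pw x n) (M * s ^ n).

Lemma growth_exists x : growth x (P x + 1).
Proof.
  pose proof (seminorm_nonneg P sP) as pos; pose proof (pos x).
  split; [lra|exists (P (one A)); split; [apply pos|]].
  induction n as [|n IH]; cbn.
  - rewrite Rmult_1_r; apply near_ideal_self.
  - apply near_ideal_le with (1 := near_ideal_mul _ _ _ _ (near_ideal_self x) IH).
    pose proof (pow_lt (P x + 1) n ltac:(lra)); pose proof (pos (one A)).
    assert (0 <= P (one A) * (P x + 1) ^ n) by nra; nra.
Qed.

Lemma growth_add x y s t : growth x s -> growth y t -> growth (add A x y) (s + t).
Proof.
  intros [hs [M [hM hx]]] [ht [N [hN hy]]]; split; [lra|].
  (* Carrying the extra factors x^a y^b through the induction lets one factor x + y be split off at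
     a time, without binomial coefficients. *)
  assert (bound : forall n a b,
    near_ideal (mul A (pw (add A x y) n) (mul A (pw x a) (pw y b)))
      (M * N * (s + t) ^ n * (s ^ a * t ^ b))).
  { induction n as [|n IH]; intros a b.
    - cbn; replace (mul A (one A) (mul A (pw x a) (pw y b)))
        with (mul A (pw x a) (pw y b)) by ring.
      apply near_ideal_le with (1 := near_ideal_mul _ _ _ _ (hx a) (hy b)); lra.
    - replace (mul A (pw (add A x y) (S n)) (mul A (pw x a) (pw y b)))
        with (add A (mul A (pw (add A x y) n) (mul A (pw x (S a)) (pw y b)))
                    (mul A (pw (add A x y) n) (mul A (pw x a) (pw y (S b)))))
        by (cbn; ring).
      apply near_ideal_le with (1 := near_ideal_add _ _ _ _ (IH (S a) b) (IH a (S b))).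
      cbn; right; ring. }
  exists (M * N); split; [nra|intros n].
  specialize (bound n O O); cbn in bound.
  replace (mul A (pw (add A x y) n) (mul A (one A) (one A)))
    with (pw (add A x y) n) in bound by ring.
  apply near_ideal_le with (1 := bound); lra.
Qed.

(** Rates are positive while |a| s vanishes for a = 0, so the new rate [t] is only required to
    dominate it. *)
Lemma growth_scal a x s t :
  growth x s -> 0 < t -> Cmod a * s <= t -> growth (mul A (cst a) x) t.
Proof.
  intros [hs [M [hM hx]]] ht hle; split; [exact ht|exists M; split; [exact hM|intros n]].
  rewrite pw_mul; apply near_ideal_le with (1 := near_ideal_pw_cst a n _ _ (hx n)).
  replace (Cmod a ^ n * (M * s ^ n)) with (M * (Cmod a * s) ^ n)
    by (rewrite Rpow_mult_distr; ring).
  apply Rmult_le_compat_l; [exact hM|apply pow_incr; split; [|exact hle]].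
  pose proof (Cmod_nonneg a); nra.
Qed.

Lemma growth_square x s : growth x s -> growth (mul A x x) (s * s).
Proof.
  intros [hs [M [hM hx]]]; split; [nra|exists M; split; [exact hM|intros n]].
  rewrite pw_mul, <- pw_add, Rpow_mult_distr, <- pow_add; apply hx.
Qed.

(** Even powers of [x] are powers of x^2. An odd power costs one more factor of size P x, absorbed
    by the summand M P(x) / s of the new constant. *)
Lemma growth_root x s : 0 < s -> growth (mul A x x) (s * s) -> growth x s.
Proof.
  intros hs [_ [M [hM hx]]]; split; [exact hs|].
  pose proof (seminorm_nonneg P sP x) as hP.
  assert (0 <= M * P x / s).
  { apply Rmult_le_pos; [nra|left; apply Rinv_0_lt_compat, hs]. }
  assert (even : forall k, near_ideal (pw x (2 * k)) (M * s ^ (2 * k))).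
  { intros k; specialize (hx k).
    replace (2 * k)%nat with (k + k)%nat by lia.
    rewrite pw_mul, <- pw_add, Rpow_mult_distr, <- pow_add in hx; exact hx. }
  exists (M + M * P x / s); split; [lra|intros n].
  destruct (Nat.Even_or_Odd n) as [[k ->]|[k ->]].
  - apply near_ideal_le with (1 := even k).
    pose proof (pow_lt s (2 * k) hs); nra.
  - replace (2 * k + 1)%nat with (S (2 * k)) by lia.
    change (pw x (S (2 * k))) with (mul A x (pw x (2 * k))).
    apply near_ideal_le with
      (1 := near_ideal_mul _ _ _ _ (near_ideal_self x) (even k)).
    change (s ^ S (2 * k)) with (s * s ^ (2 * k)).
    pose proof (pow_lt s (2 * k) hs).
    replace ((M + M * P x / s) * (s * s ^ (2 * k)))
      with (M * s * s ^ (2 * k) + P x * (M * s ^ (2 * k))) by (field; lra).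
    assert (0 <= M * s * s ^ (2 * k)) by (apply Rmult_le_pos; nra); lra.
Qed.

(** All powers except the zeroth lie in [I], so the constant only has to cover P(1), however small
    [s] is. *)
Lemma growth_ideal x s : I x -> 0 < s -> growth x s.
Proof.
  destruct idI as [_ [_ [_ [_ Imul]]]].
  intros hx hs; split; [exact hs|exists (P (one A)); split; [apply seminorm_nonneg, sP|]].
  pose proof (seminorm_nonneg P sP (one A)).
  intros [|n]; cbn.
  - rewrite Rmult_1_r; apply near_ideal_self.
  - exists (mul A x (pw x n)); split.
    + rewrite mulC; apply Imul; unfold whole; auto.
    + replace (asub A (mul A x (pw x n)) (mul A x (pw x n))) with (zero A) by ring.
      rewrite seminorm_0 by exact sP; pose proof (pow_lt s n hs).
      assert (0 <= s * s ^ n) by nra; nra.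
Qed.

Lemma growth_one s : growth (one A) s -> 1 <= s.
Proof.
  intros [hs [M [hM h]]]; apply le_of_pow_le with M; [lra|exact hs|intros n].
  exists n; split; [lia|rewrite pow1].
  assert (e : pw (one A) n = one A).
  { induction n as [|n IH]; cbn; [reflexivity|rewrite IH; ring]. }
  apply near_ideal_one; rewrite <- e; apply h.
Qed.

(** [r] is the infimum of the growth rates. Each seminorm law comes from the matching lemma on
    rates, and uniformity from [growth_square] and [growth_root], the latter applied to the square
    root of a rate of x^2. *)
Lemma spectral_seminorm : exists r, seminorm r /\ uniform r /\
  1 <= r (one A) /\ forall x, I x -> r x = 0.
Proof.
  destruct (functional_choice (fun x m => is_inf (growth x) m)) as [r hr].
  { intros x; apply inf_exists; [exists (P x + 1); apply growth_exists|].
    intros s [hs _]; lra. }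
  assert (pos : forall x, 0 <= r x) by (intros x; apply (hr x)).
  assert (low : forall x s, growth x s -> r x <= s) by (intros x s; apply (hr x)).
  assert (app : forall x t, r x < t -> exists s, growth x s /\ s < t).
  { intros x t ht; destruct (hr x) as [_ [_ h]].
    destruct (h (t - r x)) as [s [hs hlt]]; [lra|exists s; split; [exact hs|lra]]. }
  assert (ideal0 : forall x, I x -> r x = 0).
  { intros x hx; apply Rle_antisym; [|apply pos].
    apply le_of_forall_eps; intros e he; apply low, growth_ideal; [exact hx|lra]. }
  exists r; split; [|split; [|split; [|exact ideal0]]].
  - apply seminorm_of_le.
    + exact pos.
    + intros x y; apply le_of_forall_eps; intros e he.
      destruct (app x (r x + e / 2)) as [s [hs hs']]; [lra|].
      destruct (app y (r y + e / 2)) as [t [ht ht']]; [lra|].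
      pose proof (low _ _ (growth_add _ _ _ _ hs ht)); lra.
    + intros a x; rewrite scal_cst.
      apply le_mul_of_lt; [apply Cmod_nonneg|apply pos|intros t u ht hu].
      destruct (app x u hu) as [s [hs hs']].
      pose proof (Cmod_nonneg a); pose proof (proj1 hs).
      apply low, growth_scal with s; [exact hs|nra|].
      apply Rmult_le_compat; lra.
    + apply ideal0, idI.
  - intros x; apply Rle_antisym.
    + replace (r x ^ 2) with (r x * r x) by ring.
      apply le_mul_of_lt; try apply pos; intros s t hs ht.
      destruct (app x (Rmin s t)) as [u [hu hlt]]; [apply Rmin_glb_lt; assumption|].
      pose proof (low _ _ (growth_square _ _ hu)); pose proof (proj1 hu).
      pose proof (Rmin_l s t); pose proof (Rmin_r s t); nra.
    + apply le_of_forall_eps; intros e he.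
      destruct (app (mul A x x) (r (mul A x x) + e)) as [w [hw hlt]]; [lra|].
      pose proof (sqrt_lt_R0 w (proj1 hw)) as hs.
      pose proof (sqrt_sqrt w ltac:(destruct hw; lra)) as e'.
      rewrite <- e' in hw; pose proof (low _ _ (growth_root _ _ hs hw)).
      pose proof (pos x); nra.
  - apply Rnot_lt_le; intros hlt; destruct (app _ _ hlt) as [s [hs hs']].
    apply growth_one in hs; lra.
Qed.

Lemma ideal_character : exists g, mlf A whole g /\ forall x, I x -> g x = C0.
Proof.
  destruct spectral_seminorm as [r [sr [ur [r1 rI]]]].
  destruct (uniform_character r (one A) sr ur) as [g [hg [le _]]]; [lra|].
  exists g; split; [exact hg|intros x hx; apply Cmod_eq0, Rle_antisym].
  - rewrite <- (rI x hx); apply le.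
  - apply Cmod_nonneg.
Qed.

End SpectralSeminorm.
End Algebra.

(** * Characters of subalgebras *)

Definition subalgebra (B : CAlg) (S : B -> Prop) : Prop :=
  S (one B) /\ (forall x y, S x -> S y -> S (add B x y)) /\
  (forall x y, S x -> S y -> S (mul B x y)) /\ forall a x, S x -> S (scal B a x).

Section Subalgebra.
Context (B : CAlg) (S : B -> Prop) (hS : subalgebra B S).
Add Ring B_ring : (CAlg_ring B).

Lemma subalgebra_cst a : S (cst B a).
Proof. apply hS, hS. Qed.

Lemma subalgebra_zero : S (zero B).
Proof. rewrite <- cst_0; apply subalgebra_cst. Qed.

Lemma opp_scal x : opp B x = scal B (Copp C1) x.
Proof. rewrite scal_cst, cst_opp, cst_1; ring. Qed.

Lemma subalgebra_opp x : S x -> S (opp B x).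
Proof. intros hx; rewrite opp_scal; apply hS, hx. Qed.

Lemma subalgebra_sub x y : S x -> S y -> S (asub B x y).
Proof. intros hx hy; apply hS; [exact hx|apply subalgebra_opp, hy]. Qed.

Section Mlf.
Context (f : B -> Cx) (hf : mlf B S f).

Lemma mlf_one : f (one B) = C1.
Proof.
  destruct hf as [_ [_ [fm [x [hx fx]]]]].
  pose proof (fm (one B) x (proj1 hS) hx) as e.
  rewrite mul1 in e.
  assert (e' : Cmul (Csub (f (one B)) C1) (f x) = C0).
  { transitivity (Csub (Cmul (f (one B)) (f x)) (f x)); [ring|rewrite <- e; ring]. }
  apply Cmul_integral in e'; destruct e' as [e'|]; [|contradiction].
  replace (f (one B)) with (Cadd (Csub (f (one B)) C1) C1) by ring; rewrite e'; ring.
Qed.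

Lemma mlf_scal a x : S x -> f (scal B a x) = Cmul a (f x).
Proof. apply hf. Qed.

Lemma mlf_opp x : S x -> f (opp B x) = Copp (f x).
Proof. intros hx; rewrite opp_scal, mlf_scal by exact hx; ring. Qed.

Lemma mlf_sub x y : S x -> S y -> f (asub B x y) = Csub (f x) (f y).
Proof.
  intros hx hy; unfold asub; rewrite (proj1 hf), mlf_opp; auto.
  apply subalgebra_opp, hy.
Qed.

Lemma mlf_zero : f (zero B) = C0.
Proof. rewrite <- cst_0; unfold cst; rewrite mlf_scal by apply hS; ring. Qed.

Lemma mlf_kernel_maximal : maximal_ideal_of B S (fun x => S x /\ f x = C0).
Proof.
  split; [split; [|split; [|split; [|split]]]|split].
  - intros x [hx _]; exact hx.
  - split; [apply subalgebra_zero|apply mlf_zero].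
  - intros x y [hx ex] [hy ey]; split; [apply hS; assumption|].
    rewrite (proj1 hf), ex, ey by assumption; ring.
  - intros x [hx ex]; split; [apply subalgebra_opp, hx|].
    rewrite mlf_opp, ex by assumption; ring.
  - intros c x hc [hx ex]; split; [apply hS; assumption|].
    rewrite (proj1 (proj2 (proj2 hf))), ex by assumption; ring.
  - intros [_ e]; rewrite mlf_one in e; exact (C1_neq_C0 e).
  - intros J [JS [_ [Jadd [_ Jmul]]]] J1 kerJ x hx; split; [auto|].
    apply NNPP; intros fx; apply J1; pose proof (JS x hx) as Sx.
    (* If f x is nonzero, 1 is the sum of 1 - x / f(x), which [f] kills, and a multiple of [x]; so
       [J] would contain 1. *)
    replace (one B) with (add B (asub B (one B) (scal B (Cinv (f x)) x))
                                (scal B (Cinv (f x)) x)) by ring.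
    apply Jadd.
    + apply kerJ; split; [apply subalgebra_sub; [apply hS|apply hS, Sx]|].
      rewrite mlf_sub, mlf_one, mlf_scal; try apply hS; auto.
      replace (Cmul (Cinv (f x)) (f x)) with (Cmul (f x) (Cinv (f x))) by ring.
      rewrite Cinv_r by exact fx; ring.
    + rewrite scal_cst; apply Jmul; [apply subalgebra_cst|exact hx].
Qed.

End Mlf.

Lemma sig_eq (x y : {x | S x}) : proj1_sig x = proj1_sig y -> x = y.
Proof.
  destruct x as [x hx], y as [y hy]; cbn; intros <-; f_equal; apply proof_irrelevance.
Qed.

(** Makes the subset an algebra in its own right, so that [ideal_character], stated for a whole
    algebra, applies to the closure. *)
Definition subCAlg : CAlg.
Proof.
  refine {|
    car := {x | S x};
    zero := exist _ (zero B) subalgebra_zero;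
    one := exist _ (one B) (proj1 hS);
    add := fun x y => exist _ (add B (proj1_sig x) (proj1_sig y))
             (proj1 (proj2 hS) _ _ (proj2_sig x) (proj2_sig y));
    opp := fun x => exist _ (opp B (proj1_sig x)) (subalgebra_opp _ (proj2_sig x));
    mul := fun x y => exist _ (mul B (proj1_sig x) (proj1_sig y))
             (proj1 (proj2 (proj2 hS)) _ _ (proj2_sig x) (proj2_sig y));
    scal := fun a x => exist _ (scal B a (proj1_sig x))
             (proj2 (proj2 (proj2 hS)) a _ (proj2_sig x)) |};
  intros; apply sig_eq; cbn; try ring.
  - apply scalA.
  - apply scal1.
  - apply scalDl.
  - apply scalDr.
  - apply scalMl.
Defined.

Lemma mlf_of_subCAlg (g : subCAlg -> Cx) : mlf subCAlg whole g ->
  exists f : B -> Cx, mlf B S f /\ forall x : subCAlg, f (proj1_sig x) = g x.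
Proof.
  intros [ga [gs [gm [x0 [_ gx0]]]]].
  (* The value outside [S] is arbitrary: [mlf] only constrains [f] on [S]. *)
  pose (f := fun b => match excluded_middle_informative (S b) with
                      | left h => g (exist _ b h) | right _ => C0 end).
  assert (fg : forall x : subCAlg, f (proj1_sig x) = g x).
  { intros [x hx]; unfold f; cbn.
    destruct (excluded_middle_informative (S x)) as [h|h]; [|contradiction].
    f_equal; apply sig_eq; reflexivity. }
  exists f; split; [split; [|split; [|split]]|exact fg].
  - intros x y hx hy; pose (x' := exist _ x hx : subCAlg); pose (y' := exist _ y hy : subCAlg).
    change (f (proj1_sig (add subCAlg x' y'))
            = Cadd (f (proj1_sig x')) (f (proj1_sig y'))).
    rewrite !fg; apply ga; exact I.
  - intros a x hx; pose (x' := exist _ x hx : subCAlg).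
    change (f (proj1_sig (scal subCAlg a x')) = Cmul a (f (proj1_sig x'))).
    rewrite !fg; apply gs; exact I.
  - intros x y hx hy; pose (x' := exist _ x hx : subCAlg); pose (y' := exist _ y hy : subCAlg).
    change (f (proj1_sig (mul subCAlg x' y'))
            = Cmul (f (proj1_sig x')) (f (proj1_sig y'))).
    rewrite !fg; apply gm; exact I.
  - exists (proj1_sig x0); split; [apply (proj2_sig x0)|rewrite fg; exact gx0].
Qed.

End Subalgebra.

Lemma whole_subalgebra (A : CAlg) : subalgebra A whole.
Proof. repeat split. Qed.

Section AlgHom.
Context (A B : CAlg) (Phi : A -> B) (hPhi : alg_hom A B Phi).
Add Ring A_ring' : (CAlg_ring A).
Add Ring B_ring' : (CAlg_ring B).

Lemma alg_hom_sub x y : Phi (asub A x y) = asub B (Phi x) (Phi y).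
Proof.
  destruct hPhi as [h1 [h2 _]].
  unfold asub; rewrite h1, !opp_scal, h2; reflexivity.
Qed.

Lemma alg_hom_zero : Phi (zero A) = zero B.
Proof.
  replace (zero A) with (asub A (zero A) (zero A)) by ring; rewrite alg_hom_sub; ring.
Qed.

Lemma image_subalgebra : subalgebra B (image Phi).
Proof.
  destruct hPhi as [h1 [h2 [h3 h4]]]; split; [|split; [|split]].
  - exists (one A); exact h4.
  - intros _ _ [x <-] [y <-]; exists (add A x y); apply h1.
  - intros _ _ [x <-] [y <-]; exists (mul A x y); apply h3.
  - intros a _ [x <-]; exists (scal A a x); apply h2.
Qed.

Lemma mlf_comp (S : B -> Prop) f : (forall a, S (Phi a)) -> subalgebra B S ->
  mlf B S f -> mlf A whole (fun a => f (Phi a)).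
Proof.
  destruct hPhi as [h1 [h2 [h3 h4]]]; intros im hS hf; split; [|split; [|split]].
  - intros x y _ _; rewrite h1; apply hf; apply im.
  - intros a x _; rewrite h2; apply hf; apply im.
  - intros x y _ _; rewrite h3; apply hf; apply im.
  - exists (one A); split; [exact I|rewrite h4, (mlf_one B S hS f hf)].
    exact C1_neq_C0.
Qed.

End AlgHom.

(** * Seminorm topologies and Q-algebras *)

Section Topology.
Context (B : SNAlg).
Add Ring B_ring'' : (CAlg_ring B).

Lemma sn_seminorm i : seminorm B (sn B i).
Proof. split; [apply sn_triangle|apply sn_scal]. Qed.

(** Replaces the finitely many seminorms of a basic neighbourhood by a single one that dominates
    them and stays submultiplicative when they are. *)
Definition sum_sn (l : list (idx B)) (x : B) : R :=
  fold_right (fun i s => sn B i x + s) 0 l.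

Lemma sum_sn_seminorm l : seminorm B (sum_sn l).
Proof.
  induction l as [|i l [ht hs]]; split.
  - intros; cbn; lra.
  - intros; cbn; ring.
  - intros x y; cbn; specialize (ht x y); pose proof (sn_triangle B i x y).
    unfold sum_sn in *; lra.
  - intros a x; cbn; specialize (hs a x); unfold sum_sn in *; rewrite hs, sn_scal; ring.
Qed.

Lemma sum_sn_nonneg l x : 0 <= sum_sn l x.
Proof. apply (seminorm_nonneg B), sum_sn_seminorm. Qed.

Lemma sn_le_sum_sn l i x : In i l -> sn B i x <= sum_sn l x.
Proof.
  induction l as [|j l IH]; cbn; [tauto|].
  pose proof (sum_sn_nonneg l x); pose proof (seminorm_nonneg B _ (sn_seminorm j) x).
  unfold sum_sn in *; intros [->|h]; [lra|specialize (IH h); lra].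
Qed.

Lemma sum_sn_le l x d : (forall i, In i l -> sn B i x <= d) ->
  sum_sn l x <= INR (length l) * d.
Proof.
  induction l as [|j l IH]; intros h; [cbn; lra|].
  cbn [length]; rewrite S_INR; cbn.
  specialize (IH (fun i hi => h i (or_intror hi))); specialize (h j (or_introl eq_refl)).
  unfold sum_sn in *; lra.
Qed.

Lemma sum_sn_small l e : 0 < e -> exists d, 0 < d /\
  forall x, (forall i, In i l -> sn B i x < d) -> sum_sn l x < e.
Proof.
  intros he; pose proof (pos_INR (length l)) as hl.
  exists (e / (INR (length l) + 1)); split; [apply Rdiv_lt_0_compat; lra|].
  intros x hx; apply Rle_lt_trans with (1 := sum_sn_le l x _ (fun i hi => Rlt_le _ _ (hx i hi))).
  apply Rmult_lt_reg_r with (INR (length l) + 1); [lra|].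
  replace (INR (length l) * (e / (INR (length l) + 1)) * (INR (length l) + 1))
    with (INR (length l) * e) by (field; lra).
  nra.
Qed.

Lemma sum_sn_mul l : (forall i (x y : B), sn B i (mul B x y) <= sn B i x * sn B i y) ->
  forall x y, sum_sn l (mul B x y) <= sum_sn l x * sum_sn l y.
Proof.
  intros hm x y; induction l as [|i l IH]; [cbn; lra|].
  change (sum_sn (i :: l)) with (fun z => sn B i z + sum_sn l z); cbn beta.
  specialize (hm i x y).
  pose proof (sum_sn_nonneg l x); pose proof (sum_sn_nonneg l y).
  pose proof (seminorm_nonneg B _ (sn_seminorm i) x).
  pose proof (seminorm_nonneg B _ (sn_seminorm i) y).
  nra.
Qed.

Lemma closure_iff (S : B -> Prop) x : closure B S x <->
  forall l e, 0 < e -> exists y, S y /\ sum_sn l (asub B y x) < e.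
Proof.
  split.
  - intros h l e he; apply (h (fun z => sum_sn l (asub B z x) < e)).
    + intros z _ hz; destruct (sum_sn_small l (e - sum_sn l (asub B z x))) as [d [hd h']].
      { lra. }
      exists l, d; split; [exact hd|intros y _ hy].
      replace (asub B y x) with (add B (asub B y z) (asub B z x)) by ring.
      apply Rle_lt_trans with (1 := proj1 (sum_sn_seminorm l) _ _).
      specialize (h' (asub B y z) hy); lra.
    + replace (asub B x x) with (zero B) by ring.
      rewrite (seminorm_0 B _ (sum_sn_seminorm l)); exact he.
  - intros h U hU Ux; destruct (hU x Logic.I Ux) as [l [e [he hl]]].
    destruct (h l e he) as [y [Sy hy]]; exists y; split; [exact Sy|].
    apply hl; [exact Logic.I|intros i hi].
    apply Rle_lt_trans with (1 := sn_le_sum_sn l i _ hi); exact hy.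
Qed.

Lemma subset_closure (S : B -> Prop) x : S x -> closure B S x.
Proof. intros hx U _ Ux; exists x; auto. Qed.

Lemma closure_subalgebra (S : B -> Prop) :
  (forall i (x y : B), sn B i (mul B x y) <= sn B i x * sn B i y) ->
  subalgebra B S -> subalgebra B (closure B S).
Proof.
  intros hm [S1 [Sadd [Smul Sscal]]]; split; [|split; [|split]].
  - apply subset_closure, S1.
  - intros x y; rewrite !closure_iff; intros hx hy l e he.
    destruct (hx l (e / 2)) as [x' [Sx hx']]; [lra|].
    destruct (hy l (e / 2)) as [y' [Sy hy']]; [lra|].
    exists (add B x' y'); split; [auto|].
    replace (asub B (add B x' y') (add B x y)) with (add B (asub B x' x) (asub B y' y))
      by ring.
    apply Rle_lt_trans with (1 := proj1 (sum_sn_seminorm l) _ _); lra.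
  - intros x y; rewrite !closure_iff; intros hx hy l e he.
    pose proof (sum_sn_nonneg l x) as px; pose proof (sum_sn_nonneg l y) as py.
    assert (hd : 0 < e / (sum_sn l x + sum_sn l y + 2)) by (apply Rdiv_lt_0_compat; lra).
    (* Expanding x'y' - xy as (x' - x)(y' - y) + (x' - x)y + x(y' - y), with all errors below d <=
       1, gives at most d (|x| + |y| + 1), where |.| is [sum_sn l]. The 2 in place of 1 makes the
       final bound strict. *)
    pose (d := Rmin 1 (e / (sum_sn l x + sum_sn l y + 2))).
    assert (hd1 : 0 < d) by (apply Rmin_glb_lt; lra).
    assert (hd2 : d <= 1) by apply Rmin_l.
    assert (hd3 : d * (sum_sn l x + sum_sn l y + 2) <= e).
    { apply Rle_trans with (e / (sum_sn l x + sum_sn l y + 2) * (sum_sn l x + sum_sn l y + 2)).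
      - apply Rmult_le_compat_r; [lra|apply Rmin_r].
      - right; field; lra. }
    destruct (hx l d hd1) as [x' [Sx hx']]; destruct (hy l d hd1) as [y' [Sy hy']].
    exists (mul B x' y'); split; [auto|].
    replace (asub B (mul B x' y') (mul B x y))
      with (add B (add B (mul B (asub B x' x) (asub B y' y)) (mul B (asub B x' x) y))
                  (mul B x (asub B y' y))) by ring.
    pose proof (proj1 (sum_sn_seminorm l)) as tri.
    pose proof (sum_sn_mul l hm (asub B x' x) (asub B y' y)).
    pose proof (sum_sn_mul l hm (asub B x' x) y).
    pose proof (sum_sn_mul l hm x (asub B y' y)).
    pose proof (sum_sn_nonneg l (asub B x' x)); pose proof (sum_sn_nonneg l (asub B y' y)).
    pose proof (tri (add B (mul B (asub B x' x) (asub B y' y)) (mul B (asub B x' x) y))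
                  (mul B x (asub B y' y))).
    pose proof (tri (mul B (asub B x' x) (asub B y' y)) (mul B (asub B x' x) y)).
    assert (sum_sn l (asub B x' x) * sum_sn l (asub B y' y) <= d) by nra.
    assert (sum_sn l (asub B x' x) * sum_sn l y <= d * sum_sn l y) by nra.
    assert (sum_sn l x * sum_sn l (asub B y' y) <= d * sum_sn l x) by nra.
    lra.
  - intros a x; rewrite !closure_iff; intros hx l e he.
    pose proof (Cmod_nonneg a).
    destruct (hx l (e / (Cmod a + 1))) as [x' [Sx hx']]; [apply Rdiv_lt_0_compat; lra|].
    exists (scal B a x'); split; [auto|].
    replace (asub B (scal B a x') (scal B a x)) with (scal B a (asub B x' x))
      by (rewrite !scal_cst; ring).
    rewrite (proj2 (sum_sn_seminorm l)).
    apply (Rmult_lt_compat_l (Cmod a + 1)) in hx'; [|lra].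
    replace ((Cmod a + 1) * (e / (Cmod a + 1))) with e in hx' by (field; lra).
    pose proof (sum_sn_nonneg l (asub B x' x)); nra.
Qed.

Lemma Ccont_of_bound (S : B -> Prop) f K l : 0 <= K ->
  (forall x y, S x -> S y -> Cmod (Csub (f y) (f x)) <= K * sum_sn l (asub B y x)) ->
  Ccont B S f.
Proof.
  intros hK hf U hU x Sx Ux; destruct (hU (f x) Logic.I Ux) as [l' [e [he h]]].
  destruct (sum_sn_small l (e / (K + 1))) as [d [hd hl]]; [apply Rdiv_lt_0_compat; lra|].
  exists l, d; split; [exact hd|intros y Sy hy].
  apply h; [exact Logic.I|intros i _].
  apply Rle_lt_trans with (1 := hf x y Sx Sy); specialize (hl _ hy).
  apply (Rmult_lt_compat_l (K + 1)) in hl; [|lra].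
  replace ((K + 1) * (e / (K + 1))) with e in hl by (field; lra).
  pose proof (sum_sn_nonneg l (asub B y x)); nra.
Qed.

(** * Bounds for characters, and characters of Q-algebras *)

Section MlfBounds.
Context (S : B -> Prop) (hS : subalgebra B S).

(** If the bound failed at [x], then x / f(x) would lie in the neighbourhood, where the value 1 is
    excluded. Continuity and the Q-property each provide such a neighbourhood. *)
Lemma mlf_bound f l e : mlf B S f -> 0 < e ->
  (forall x, S x -> (forall i, In i l -> sn B i x < e) -> f x <> C1) ->
  forall x, S x -> Cmod (f x) <= sum_sn l x / e.
Proof.
  intros hf he h x Sx; apply Rnot_lt_le; intros hlt.
  pose proof (sum_sn_nonneg l x) as pos.
  assert (0 <= sum_sn l x / e) by (apply Rmult_le_pos; [|left; apply Rinv_0_lt_compat]; lra).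
  assert (fx : f x <> C0) by (intros e0; rewrite e0, Cmod_C0 in hlt; lra).
  apply (h (scal B (Cinv (f x)) x)).
  - apply hS, Sx.
  - intros i hi; rewrite sn_scal, Cmod_inv by exact fx.
    pose proof (sn_le_sum_sn l i x hi).
    apply Rmult_lt_reg_l with (Cmod (f x)); [lra|].
    rewrite <- Rmult_assoc, Rinv_r, Rmult_1_l by lra.
    apply (Rmult_lt_compat_r e) in hlt; [|exact he].
    replace (sum_sn l x / e * e) with (sum_sn l x) in hlt by (field; lra); lra.
  - rewrite (mlf_scal B S f hf) by exact Sx.
    replace (Cmul (Cinv (f x)) (f x)) with (Cmul (f x) (Cinv (f x))) by ring.
    apply Cinv_r, fx.
Qed.

Lemma mlf_Ccont_of_bound f l e : mlf B S f -> 0 < e ->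
  (forall x, S x -> Cmod (f x) <= sum_sn l x / e) -> Mcont B S f.
Proof.
  intros hf he h; split; [exact hf|].
  pose proof (Rinv_0_lt_compat e he).
  apply Ccont_of_bound with (K := / e) (l := l); [lra|].
  intros x y Sx Sy; rewrite <- (mlf_sub B S hS f hf) by assumption.
  rewrite Rmult_comm; apply h, subalgebra_sub; assumption.
Qed.

Lemma mlf_bound_of_Ccont f : Mcont B S f -> exists l e, 0 < e /\
  forall x, S x -> Cmod (f x) <= sum_sn l x / e.
Proof.
  intros [hf cf].
  assert (openU : sopen Cseminorm Csub whole (fun z => Cmod z < 1)).
  { intros z _ hz; exists (tt :: nil), (1 - Cmod z); split; [lra|intros w _ hw].
    specialize (hw tt (or_introl eq_refl)); unfold Cseminorm in hw.
    replace w with (Cadd (Csub w z) z) by ring.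
    apply Rle_lt_trans with (1 := Cmod_triangle _ _); lra. }
  destruct (cf _ openU (zero B)) as [l [e [he h]]].
  - apply subalgebra_zero, hS.
  - rewrite (mlf_zero B S hS f hf), Cmod_C0; lra.
  - exists l, e; split; [exact he|apply mlf_bound; auto].
    intros x Sx hx fx; assert (hlt : Cmod (f x) < 1).
    { apply h; [exact Sx|intros i hi].
      replace (asub B x (zero B)) with x by ring; auto. }
    rewrite fx, Cmod_C1 in hlt; lra.
Qed.

Section QAlgebra.
Context (hQ : Q_algebra B S).

(** Openness of the invertible elements at 1. The radius is kept at most 1 so that [sum_sn l x / e]
    is again submultiplicative. *)
Lemma Q_algebra_inverse : exists l e, 0 < e <= 1 /\
  forall x, S x -> (forall i, In i l -> sn B i x < e) ->
    exists y, S y /\ mul B (asub B (one B) x) y = one B.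
Proof.
  destruct (hQ (one B)) as [l [e [he h]]].
  - apply hS.
  - split; [apply hS|exists (one B); split; [apply hS|ring]].
  - exists l, (Rmin e 1); split; [split; [apply Rmin_glb_lt; lra|apply Rmin_r]|].
    intros x Sx hx; apply h.
    + apply (subalgebra_sub B S hS); [apply hS|exact Sx].
    + intros i hi; replace (asub B (asub B (one B) x) (one B)) with (opp B x) by ring.
      rewrite (seminorm_opp B _ (sn_seminorm i)).
      apply Rlt_le_trans with (1 := hx i hi), Rmin_l.
Qed.

(** If f x = 1 then f kills 1 - x, which is therefore not invertible. The neighbourhood where 1 - x
    is invertible does not depend on [f], hence neither does the bound. *)
Lemma Q_algebra_mlf_bound : exists l e, 0 < e /\
  forall f, mlf B S f -> forall x, S x -> Cmod (f x) <= sum_sn l x / e.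
Proof.
  destruct Q_algebra_inverse as [l [e [[he _] h]]].
  exists l, e; split; [exact he|intros f hf; apply mlf_bound; auto].
  intros x Sx hx fx; destruct (h x Sx hx) as [y [Sy e1]].
  apply C1_neq_C0; rewrite <- (mlf_one B S hS f hf), <- e1.
  rewrite (proj1 (proj2 (proj2 hf)));
    [|apply (subalgebra_sub B S hS); [apply hS|exact Sx]|exact Sy].
  rewrite (mlf_sub B S hS f hf), (mlf_one B S hS f hf), fx by (assumption || apply hS).
  ring.
Qed.

Context (hm : forall i (x y : B), sn B i (mul B x y) <= sn B i x * sn B i y).

Lemma Q_algebra_ideal_mlf I : ideal_of B S I -> ~ I (one B) ->
  exists f, mlf B S f /\ forall x, I x -> f x = C0.
Proof.
  intros [IS [I0 [Iadd [Iopp Imul]]]] I1.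
  destruct Q_algebra_inverse as [l [e [[he he1] h]]].
  pose proof (Rinv_0_lt_compat e he) as ie.
  destruct (ideal_character (subCAlg B S hS) (fun x => sum_sn l (proj1_sig x) / e))
    with (I := fun x : subCAlg B S hS => I (proj1_sig x)) as [g [hg gI]].
  - split.
    + intros x y; cbn; unfold Rdiv; rewrite <- Rmult_plus_distr_r.
      apply Rmult_le_compat_r; [lra|apply sum_sn_seminorm].
    + intros a x; cbn; rewrite (proj2 (sum_sn_seminorm l)); field; lra.
  - intros x y; cbn; pose proof (sum_sn_mul l hm (proj1_sig x) (proj1_sig y)).
    pose proof (sum_sn_nonneg l (proj1_sig x)); pose proof (sum_sn_nonneg l (proj1_sig y)).
    assert (1 <= / e) by (rewrite <- Rinv_1; apply Rinv_le_contravar; lra).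
    assert (0 <= sum_sn l (proj1_sig x) * sum_sn l (proj1_sig y)) by nra.
    unfold Rdiv; apply Rle_trans with (sum_sn l (proj1_sig x) * sum_sn l (proj1_sig y) * / e).
    + apply Rmult_le_compat_r; lra.
    + replace (sum_sn l (proj1_sig x) * / e * (sum_sn l (proj1_sig y) * / e))
        with (sum_sn l (proj1_sig x) * sum_sn l (proj1_sig y) * / e * / e) by ring.
      assert (0 <= sum_sn l (proj1_sig x) * sum_sn l (proj1_sig y) * / e) by nra; nra.
  - intros x hx; destruct (h (proj1_sig x) (proj2_sig x)) as [y [Sy hy]].
    + intros i hi; apply Rle_lt_trans with (1 := sn_le_sum_sn l i _ hi).
      apply (Rmult_lt_compat_r e) in hx; [|exact he].
      replace (sum_sn l (proj1_sig x) / e * e) with (sum_sn l (proj1_sig x)) in hx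
        by (field; lra); lra.
    + exists (exist _ y Sy : subCAlg B S hS); apply sig_eq; exact hy.
  - split; [|split; [|split; [|split]]].
    + intros; exact Logic.I.
    + exact I0.
    + intros x y; apply Iadd.
    + intros x; apply Iopp.
    + intros c x _; apply Imul, (proj2_sig c).
  - exact I1.
  - destruct (mlf_of_subCAlg B S hS g hg) as [f [hf fg]].
    exists f; split; [exact hf|intros x Ix].
    rewrite <- (gI (exist _ x (IS x Ix) : subCAlg B S hS) Ix), <- fg; reflexivity.
Qed.

(** A maximal ideal is killed by some character, whose kernel is a proper ideal; by maximality it
    contains that kernel, hence [x]. *)
Lemma radical_of_mlf x : S x -> (forall f, mlf B S f -> f x = C0) -> radical B S x.
Proof.
  intros Sx h; split; [exact Sx|intros I [idI [I1 max]]].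
  destruct (Q_algebra_ideal_mlf I idI I1) as [f [hf fI]].
  destruct (mlf_kernel_maximal B S hS f hf) as [idK [K1 _]].
  apply (max _ idK K1); [|auto].
  intros y Iy; split; [apply idI, Iy|auto].
Qed.

End QAlgebra.
End MlfBounds.
End Topology.

(** * Extension of characters to the closure *)

Section Extension.
Context (A : CAlg) (B : SNAlg) (Phi : A -> B) (hPhi : alg_hom A B Phi).
Context (hm : forall i (x y : B), sn B i (mul B x y) <= sn B i x * sn B i y).
Add Ring A_ring : (CAlg_ring A).
Add Ring B_ring3 : (CAlg_ring B).

(** The value at c is the limit of h(a) as Phi a tends to c for the single seminorm [P]. The
    estimate |f(c) - h(a)| <= 2 P(Phi a - c) then yields every law by approximation. Only a bound on
    [h] is assumed, which also covers limits of restricted characters. *)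
Lemma mlf_extend_to_closure h l e : mlf A whole h -> 0 < e ->
  (forall a, Cmod (h a) <= sum_sn B l (Phi a) / e) ->
  exists f, Mcont B (closure B (image Phi)) f /\ forall a, f (Phi a) = h a.
Proof.
  intros hh he bd; set (C := closure B (image Phi)).
  pose (P := fun x => sum_sn B l x / e).
  pose proof (Rinv_0_lt_compat e he) as ie.
  assert (sP : seminorm B P).
  { split; unfold P.
    - intros x y; unfold Rdiv; rewrite <- Rmult_plus_distr_r.
      apply Rmult_le_compat_r; [lra|apply sum_sn_seminorm].
    - intros a x; rewrite (proj2 (sum_sn_seminorm B l)); field; lra. }
  pose proof (seminorm_nonneg B P sP) as P0.
  assert (mP : forall x y, P (mul B x y) <= e * (P x * P y)).
  { intros x y; unfold P.
    replace (e * (sum_sn B l x / e * (sum_sn B l y / e)))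
      with (sum_sn B l x * sum_sn B l y / e) by (field; lra).
    apply Rmult_le_compat_r; [lra|apply sum_sn_mul, hm]. }
  assert (hC : subalgebra B C).
  { apply closure_subalgebra, image_subalgebra, hPhi; exact hm. }
  assert (approx : forall c t, C c -> 0 < t -> exists a, P (asub B (Phi a) c) < t).
  { intros c t hc ht; destruct (proj1 (closure_iff B _ c) hc l (t * e)) as [_ [[a <-] ha]].
    - nra.
    - exists a; unfold P; apply Rmult_lt_reg_r with e; [exact he|].
      replace (sum_sn B l (asub B (Phi a) c) / e * e)
        with (sum_sn B l (asub B (Phi a) c)) by (field; lra); exact ha. }
  pose proof (whole_subalgebra A) as hA.
  assert (lim : forall c, exists w, C c ->
    forall a, Cmod (Csub w (h a)) <= 2 * P (asub B (Phi a) c)).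
  { intros c; destruct (classic (C c)) as [hc|]; [|exists C0; tauto].
    destruct (C_complete (fun t z => exists a, P (asub B (Phi a) c) <= t /\ h a = z))
      as [w hw].
    - exists (P (asub B (Phi (zero A)) c)), (h (zero A)), (zero A); split; [lra|reflexivity].
    - intros t t' z z' [a [ha <-]] [a' [ha' <-]].
      rewrite <- (mlf_sub A whole hA h hh) by exact I.
      apply Rle_trans with (1 := bd _).
      change (P (Phi (asub A a a')) <= t + t'); rewrite (alg_hom_sub A B Phi hPhi).
      replace (asub B (Phi a) (Phi a'))
        with (asub B (asub B (Phi a) c) (asub B (Phi a') c)) by ring.
      pose proof (seminorm_sub B P sP (asub B (Phi a) c) (asub B (Phi a') c)); lra.
    - exists w; intros _ a; apply hw; exists a; split; [lra|reflexivity]. }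
  destruct (functional_choice _ lim) as [f hf]; clear lim.
  assert (fPhi : forall a, f (Phi a) = h a).
  { intros a; apply eq_of_Cmod_small; intros d hd.
    assert (hc : C (Phi a)) by (apply subset_closure; exists a; reflexivity).
    apply Rle_trans with (1 := hf _ hc a).
    replace (asub B (Phi a) (Phi a)) with (zero B) by ring.
    rewrite (seminorm_0 B P sP); lra. }
  assert (fadd : forall x y, C x -> C y -> f (add B x y) = Cadd (f x) (f y)).
  { intros x y hx hy; apply eq_of_Cmod_small; intros d hd.
    destruct (approx x (d / 8) hx) as [a ha]; [lra|].
    destruct (approx y (d / 8) hy) as [b hb]; [lra|].
    pose proof (hf _ hx a) as h1; pose proof (hf _ hy b) as h2.
    assert (h3 := hf (add B x y) (proj1 (proj2 hC) _ _ hx hy) (add A a b)).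
    rewrite (proj1 hPhi), (proj1 hh) in h3 by exact I.
    replace (asub B (add B (Phi a) (Phi b)) (add B x y))
      with (add B (asub B (Phi a) x) (asub B (Phi b) y)) in h3 by ring.
    pose proof (proj1 sP (asub B (Phi a) x) (asub B (Phi b) y)).
    replace (Csub (f (add B x y)) (Cadd (f x) (f y)))
      with (Cadd (Csub (f (add B x y)) (Cadd (h a) (h b)))
             (Copp (Cadd (Csub (f x) (h a)) (Csub (f y) (h b))))) by ring.
    apply Rle_trans with (1 := Cmod_triangle _ _); rewrite Cmod_opp.
    pose proof (Cmod_triangle (Csub (f x) (h a)) (Csub (f y) (h b))); lra. }
  assert (fsub' : forall x y, C x -> C y -> f (asub B x y) = Csub (f x) (f y)).
  { intros x y hx hy; pose proof (fadd (asub B x y) y) as e'.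
    replace (add B (asub B x y) y) with x in e' by ring.
    rewrite e' by (try apply (subalgebra_sub B C hC); assumption); ring. }
  assert (fle : forall x, C x -> Cmod (f x) <= 2 * P x).
  { intros x hx; pose proof (hf x hx (zero A)) as h1.
    rewrite (mlf_zero A whole hA h hh), (alg_hom_zero A B Phi hPhi) in h1.
    rewrite (seminorm_sub_sym B P sP) in h1.
    replace (asub B x (zero B)) with x in h1 by ring.
    replace (Csub (f x) C0) with (f x) in h1 by ring; exact h1. }
  assert (small : forall K x, 0 <= K -> (forall d, 0 < d -> Cmod x <= K * d) -> x = C0).
  { intros K x hK hx; apply eq_of_Cmod_small; intros d hd.
    replace (Csub x C0) with x by ring.
    apply Rle_trans with (1 := hx (d / (K + 1)) ltac:(apply Rdiv_lt_0_compat; lra)).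
    apply Rmult_le_reg_r with (K + 1); [lra|].
    replace (K * (d / (K + 1)) * (K + 1)) with (K * d) by (field; lra); nra. }
  assert (sub_eq : forall z w, Csub z w = C0 -> z = w).
  { intros z w e'; replace z with (Cadd (Csub z w) w) by ring; rewrite e'; ring. }
  assert (imC : forall a, C (Phi a)) by (intros a; apply subset_closure; exists a; reflexivity).
  (* Multiplicativity comes in two stages: one factor in the image first, then the second factor is
     approximated from the image. *)
  assert (fmul1 : forall x b, C x -> f (mul B x (Phi b)) = Cmul (f x) (h b)).
  { intros x b hx; apply sub_eq.
    apply (small (2 * (e * P (Phi b)) + Cmod (h b) * 2)).
    { pose proof (P0 (Phi b)); pose proof (Cmod_nonneg (h b)); nra. }
    intros d hd; destruct (approx x d hx hd) as [a ha].
    assert (hxb : C (mul B x (Phi b))) by (apply hC; auto).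
    pose proof (hf _ hxb (mul A a b)) as h1; pose proof (hf _ hx a) as h2.
    rewrite (proj1 (proj2 (proj2 hh))), (proj1 (proj2 (proj2 hPhi))) in h1 by exact I.
    replace (asub B (mul B (Phi a) (Phi b)) (mul B x (Phi b)))
      with (mul B (asub B (Phi a) x) (Phi b)) in h1 by ring.
    pose proof (mP (asub B (Phi a) x) (Phi b)) as h3.
    replace (Csub (f (mul B x (Phi b))) (Cmul (f x) (h b)))
      with (Cadd (Csub (f (mul B x (Phi b))) (Cmul (h a) (h b)))
             (Copp (Cmul (h b) (Csub (f x) (h a))))) by ring.
    apply Rle_trans with (1 := Cmod_triangle _ _); rewrite Cmod_opp, Cmod_mul.
    pose proof (P0 (Phi b)); pose proof (Cmod_nonneg (h b)).
    pose proof (P0 (asub B (Phi a) x)).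
    assert (Cmod (h b) * Cmod (Csub (f x) (h a)) <= Cmod (h b) * (2 * d))
      by (apply Rmult_le_compat_l; lra).
    assert (P (asub B (Phi a) x) * P (Phi b) <= d * P (Phi b)) by nra.
    assert (e * (P (asub B (Phi a) x) * P (Phi b)) <= e * (d * P (Phi b))) by nra.
    lra. }
  assert (fmul : forall x y, C x -> C y -> f (mul B x y) = Cmul (f x) (f y)).
  { intros x y hx hy; apply sub_eq.
    apply (small (2 * (e * P x) + Cmod (f x) * 2)).
    { pose proof (P0 x); pose proof (Cmod_nonneg (f x)); nra. }
    intros d hd; destruct (approx y d hy hd) as [b hb].
    assert (hxy : C (mul B x y)) by (apply hC; auto).
    pose proof (hf _ hy b) as h1.
    assert (h2 : Cmod (f (mul B x (asub B (Phi b) y)))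
                 <= 2 * P (mul B x (asub B (Phi b) y))).
    { apply fle, hC; [exact hx|apply (subalgebra_sub B C hC); auto]. }
    replace (mul B x (asub B (Phi b) y))
      with (asub B (mul B x (Phi b)) (mul B x y)) in h2 at 1 by ring.
    rewrite fsub', fmul1 in h2 by (try apply hC; auto).
    pose proof (mP x (asub B (Phi b) y)) as h3.
    replace (Csub (f (mul B x y)) (Cmul (f x) (f y)))
      with (Copp (Cadd (Csub (Cmul (f x) (h b)) (f (mul B x y)))
             (Cmul (f x) (Csub (f y) (h b))))) by ring.
    rewrite Cmod_opp; apply Rle_trans with (1 := Cmod_triangle _ _); rewrite Cmod_mul.
    pose proof (P0 x); pose proof (Cmod_nonneg (f x)).
    pose proof (P0 (asub B (Phi b) y)).
    assert (Cmod (f x) * Cmod (Csub (f y) (h b)) <= Cmod (f x) * (2 * d))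
      by (apply Rmult_le_compat_l; lra).
    assert (P x * P (asub B (Phi b) y) <= P x * d) by nra.
    assert (e * (P x * P (asub B (Phi b) y)) <= e * (P x * d)) by nra.
    lra. }
  exists f; split; [|exact fPhi].
  (* The half accounts for the factor 2 in the bound |f| <= 2 P. *)
  apply mlf_Ccont_of_bound with (l := l) (e := e / 2); [exact hC| |lra|].
  - split; [exact fadd|split; [|split; [exact fmul|]]].
    + intros a x hx; rewrite scal_cst.
      replace (cst B a) with (Phi (cst A a)).
      * rewrite mulC, fmul1 by exact hx; unfold cst.
        rewrite (mlf_scal A whole h hh), (mlf_one A whole hA h hh) by exact I; ring.
      * unfold cst; destruct hPhi as [_ [h2 [_ h4]]]; rewrite h2, h4; reflexivity.
    + exists (Phi (one A)); split; [apply imC|].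
      rewrite fPhi, (mlf_one A whole hA h hh); exact C1_neq_C0.
  - intros x hx; apply Rle_trans with (1 := fle x hx); unfold P; right; field; lra.
Qed.

End Extension.

(** * Equivalence of the four conditions *)

Theorem theorem3p1 (A B : SNAlg) (Phi : A -> B) :
  is_uT A -> weakly_regular A -> functionally_continuous A whole ->
  is_lmc B -> alg_hom A B Phi -> (forall x y, Phi x = Phi y -> x = y) ->
  Q_algebra B (closure B (image Phi)) ->
  let P1 := forall g : B -> A, (forall a, g (Phi a) = a) ->
              Acont B (image Phi) A whole g in
  let P2 := functionally_continuous B (image Phi) in
  let P3 := forall g, Mcont A whole g ->
              exists f, Mcont B (closure B (image Phi)) f /\
                        forall a, f (Phi a) = g a in
  let P4 := forall b, image Phi b -> radical B (closure B (image Phi)) b ->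
              b = zero B in
  (P1 <-> P2) /\ (P1 <-> P3) /\ (P1 <-> P4).
Proof.
  intros [[hausA _] unif] wreg fcA [_ hm] hPhi inj hQ P1 P2 P3 P4.
  set (C := closure B (image Phi)) in *.
  pose proof (image_subalgebra A B Phi hPhi) as hIm.
  pose proof (closure_subalgebra B (image Phi) hm hIm : subalgebra B C) as hC.
  assert (imIm : forall a, image Phi (Phi a)) by (intros a; exists a; reflexivity).
  assert (imC : forall a, C (Phi a)) by (intros a; apply subset_closure, imIm).
  destruct (Q_algebra_mlf_bound B C hC hQ) as [l [e [he bd]]].
  (* A total function on [B] is required, so the inverse is extended by 0 off the image. *)
  assert (inverse : exists psi : B -> A, forall a, psi (Phi a) = a).
  { destruct (functional_choice (fun b a => forall a', Phi a' = b -> a = a')) as [psi h].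
    - intros b; destruct (classic (image Phi b)) as [[a <-]|hb].
      + exists a; intros a' h; apply inj; auto.
      + exists (zero A); intros a' h; exfalso; apply hb; exists a'; exact h.
    - exists psi; intros a; auto. }
  destruct inverse as [psi hpsi].
  assert (P12 : P1 -> P2).
  { intros h f hf; split; [exact hf|].
    destruct (fcA _ (mlf_comp A B Phi hPhi (image Phi) f imIm hIm hf)) as [_ cf].
    intros U hU x Sx Ux.
    destruct (h psi hpsi _ (cf U hU) x Sx) as [l' [d [hd hl]]].
    - destruct Sx as [a <-]; rewrite hpsi; exact Ux.
    - exists l', d; split; [exact hd|intros y Sy hy].
      specialize (hl y Sy hy); destruct Sy as [a <-]; rewrite hpsi in hl; exact hl. }
  assert (P23 : P2 -> P3).
  { intros h g [hg _].
    assert (hf : mlf B (image Phi) (fun b => g (psi b))).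
    { destruct hPhi as [h1 [h2 [h3 h4]]]; split; [|split; [|split]].
      - intros _ _ [x <-] [y <-]; rewrite <- h1, !hpsi; apply hg; exact I.
      - intros a _ [x <-]; rewrite <- h2, !hpsi; apply hg; exact I.
      - intros _ _ [x <-] [y <-]; rewrite <- h3, !hpsi; apply hg; exact I.
      - destruct hg as [_ [_ [_ [x [_ hx]]]]]; exists (Phi x); rewrite hpsi; auto. }
    destruct (mlf_bound_of_Ccont B (image Phi) hIm _ (h _ hf)) as [l' [d [hd hl]]].
    apply (mlf_extend_to_closure A B Phi hPhi hm g l' d hg hd).
    intros a; rewrite <- (hpsi a) at 1; apply hl, imIm. }
  assert (sep : forall i x, 0 < sn A i x ->
    exists g, Mcont A whole g /\ Cmod (g x) = sn A i x).
  { intros i x hx.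
    destruct (uniform_character A (sn A i) x (sn_seminorm A i) (unif i) hx)
      as [g [hg [_ gx]]].
    exists g; split; [apply fcA, hg|exact gx]. }
  assert (P34 : P3 -> P4).
  { intros h _ [a <-] [_ rad]; apply NNPP; intros hne.
    destruct (hausA a) as [i hi].
    { intros ->; apply hne, alg_hom_zero, hPhi. }
    pose proof (seminorm_nonneg A _ (sn_seminorm A i) a).
    destruct (sep i a ltac:(lra)) as [g [hg ga]].
    destruct (h g hg) as [f [[hf _] fg]].
    destruct (rad _ (mlf_kernel_maximal B C hC f hf)) as [_ fa].
    rewrite <- fg, fa, Cmod_C0 in ga; lra. }
  assert (P43 : P4 -> P3).
  { intros h; apply NNPP; intros hn.
    pose (F := fun g => Mcont A whole g /\
      exists f, Mcont B C f /\ forall a, f (Phi a) = g a).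
    destruct (wreg F) as [x [xne hx]].
    - intros g [hg _]; exact hg.
    - apply NNPP; intros hn'; apply hn; intros g hg; apply NNPP; intros hn''.
      apply hn'; exists g; split; [exact hg|intros [_ hF]; exact (hn'' hF)].
    (* [F] is closed: if every neighbourhood of g meets [F], the common bound [bd] passes to g up to
       every [d], and a bounded g extends to [C], so g is in [F]. *)
    - intros g hg gF; apply NNPP; intros hopen; apply gF; split; [exact hg|].
      apply (mlf_extend_to_closure A B Phi hPhi hm g l e (proj1 hg) he).
      intros a; apply le_of_forall_eps; intros d hd; apply NNPP; intros hlt.
      apply hopen; exists (a :: nil), d; split; [exact hd|].
      intros g' _ close [_ [f [[hf _] fg']]]; apply hlt.
      specialize (close a (or_introl eq_refl)); unfold wstar_seminorm, fsub in close.
      specialize (bd f hf (Phi a) (imC a)); rewrite fg' in bd.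
      replace (g a) with (Cadd (g' a) (Copp (Csub (g' a) (g a)))) by ring.
      apply Rle_trans with (1 := Cmod_triangle _ _); rewrite Cmod_opp; lra.
    - apply xne, inj; rewrite (alg_hom_zero A B Phi hPhi).
      apply h; [apply imIm|].
      apply (radical_of_mlf B C hC hQ hm); [apply imC|intros f hf].
      (* Any character of [C] restricts to a member of [F]: [bd] makes it continuous, and functional
         continuity of [A] does the same for its restriction. *)
      apply (hx (fun a => f (Phi a))); split.
      + apply fcA, (mlf_comp A B Phi hPhi C f imC hC hf).
      + exists f; split; [|reflexivity].
        apply (mlf_Ccont_of_bound B C hC f l e hf he), bd, hf. }
  assert (P31 : P3 -> P1).
  { intros h psi' hpsi' U hU _ [a <-] Ua; rewrite hpsi' in Ua.
    destruct (hU a Logic.I Ua) as [l' [d [hd hl]]].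
    (* The same list [l] controls all seminorms of [A], since [bd] holds for every character; d e
       cancels the division by e there. *)
    destruct (sum_sn_small B l (d * e)) as [d' [hd' small]]; [nra|].
    exists l, d'; split; [exact hd'|intros _ [a' <-] close].
    rewrite hpsi'; apply hl; [exact Logic.I|intros i _].
    specialize (small _ close); rewrite <- (alg_hom_sub A B Phi hPhi) in small.
    (* A norming character is available only for a positive value; the value 0 is below [d]
       anyway. *)
    destruct (seminorm_nonneg A _ (sn_seminorm A i) (asub A a' a)) as [pos|zero].
    - destruct (sep i _ pos) as [g [hg ga]]; rewrite <- ga.
      destruct (h g hg) as [f [[hf _] fg]]; rewrite <- fg.
      apply Rle_lt_trans with (1 := bd f hf _ (imC _)).
      apply Rmult_lt_reg_r with e; [exact he|].
      replace (sum_sn B l (Phi (asub A a' a)) / e * e)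
        with (sum_sn B l (Phi (asub A a' a))) by (field; lra); exact small.
    - rewrite <- zero; exact hd. }
  split; [split|split; split]; auto.
Qed.
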